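(* Let $G$ be a finite connected digraph containing neither a double arrow, nor a triangle, nor a square. Let $0<\lambda_1<\dots<\lambda_s$ be all the distinct positive eigenvalues of the canonical Hodge Laplacian $\Delta_0(G)$ and let $m_1,\dots,m_s$ be their multiplicities. Let $n\ge 1$ and let $\Delta_r^{(a)}(G^n)$ be the normalized Hodge Laplacian of $G^n$. (a) Assume that $G$ has $v$ vertices and $v$ arrows, where $v\ge 3$. Then, for all $0\le r\le n$, $$\operatorname{spec}\Delta_r^{(a)}(G^n)=\Big\{(k_1\lambda_1+\dots+k_s\lambda_s)_{m_1^{k_1}\cdots m_s^{k_s}\binom{n}{k_1\,\dots\,k_s}\binom{n}{r}}\ \Big|\ k_1,\dots,k_s\ge 0,\ k_1+\dots+k_s\le n\Big\}.$$ Consequently, $$\lambda_{\max}(\Delta_r^{(a)}(G^n))=(n\lambda_s)_{m_s^n\binom nr}\quad\text{and}\quad \lambda_{\min}(\Delta_r^{(a)}(G^n))=0_{\binom nr}.$$ (b) Assume that $G$ has $v$ vertices and $v-1$ arrows, where $v\ge 2$. Then, for all $0\le r\le n$, $$\operatorname{spec}\Delta_r^{(a)}(G^n)=\Big\{(k_1\lambda_1+\dots+k_s\lambda_s)_{m_1^{k_1}\cdots m_s^{k_s}\binom{n}{k_1\,\dots\,k_s}\binom{k_1+\dots+k_s}{r}}\ \Big|\ k_1,\dots,k_s\ge 0,\ r\le k_1+\dots+k_s\le n\Big\}.$$ Consequently, $$\lambda_{\max}(\Delta_r^{(a)}(G^n))=(n\lambda_s)_{m_s^n\binom nr}\quad\text{and}\quad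 \lambda_{\min}(\Delta_r^{(a)}(G^n))=(r\lambda_1)_{m_1^r\binom nr}.$$
   Context: A digraph $G=(V,E)$ consists of a finite vertex set $V$ and a set $E$ of ordered pairs of distinct vertices (arrows), written $i\to j$. It is connected if the underlying undirected graph is connected. An elementary $p$-path ($p\ge 0$) is a sequence $i_0\dots i_p$ of vertices, with associated basis symbol $e_{i_0\dots i_p}$; it is regular if $i_{k-1}\ne i_k$ for all $k$, and allowed if $i_{k-1}\to i_k$ for all $k$. $\mathcal R_p$ is the real vector space with basis the regular elementary $p$-paths. The boundary operator $\partial:\mathcal R_p\to\mathcal R_{p-1}$ is $\partial e_{i_0\dots i_p}=\sum_{k=0}^p(-1)^k e_{i_0\dots\widehat{i_k}\dots i_p}$, where every non-regular term on the right is replaced by $0$; and $\mathcal R_{-1}=\{0\}$, $\partial e_i=0$. $\mathcal A_p\subset\mathcal R_p$ is the span of the allowed elementary $p$-paths ($\mathcal A_{-1}=\{0\}$), and $\Omega_p=\Omega_p(G)=\{u\in\mathcal A_p:\partial u\in\mathcal A_{p-1}\}$. Then $\partial\Omega_p\subset\Omega_{p-1}$ and $\partial^2=0$. Given inner products on the spaces $\Omega_p$, the Hodge Laplacian on $\Omega_p$ is $\partial\partial^*+\partial^*\partial$, where $\partial^*:\Omega_{p-1}\to\Omega_p$ is the adjoint of $\partial:\Omega_p\to\Omega_{p-1}$. The canonical Hodge Laplacian $\Delta_p(G)$ corresponds to the inner product $\langle\cdot,\cdot\rangle$ (restricted from $\mathcal R_p$) for which the regular elementary paths are orthonormal. The normalized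 Hodge Laplacian $\Delta_p^{(a)}(G)$ corresponds to the inner product $\langle\cdot,\cdot\rangle_a=\frac{1}{p!}\langle\cdot,\cdot\rangle$ on $\mathcal R_p$ (weight $a_p=p!$). The Cartesian product $X\Box Y$ of digraphs has vertex set $X\times Y$, with $(x_1,y_1)\to(x_2,y_2)$ iff either $x_1=x_2$ and $y_1\to y_2$, or $x_1\to x_2$ and $y_1=y_2$. $G^n=G\Box\cdots\Box G$ ($n$ factors). A double arrow is a pair of distinct vertices $i,j$ with $i\to j\to i$. A triangle is formed by three distinct vertices $i,j,k$ with $i\to j\to k$ and $i\to k$. A square is formed by four distinct vertices $i,j,j',k$ with $i\to j\to k$, $i\to j'\to k$ and $i\not\to k$. $\operatorname{spec}A$ is the multiset (unordered sequence) of eigenvalues of the self-adjoint operator $A$, counted with multiplicity. The notation $(\lambda)_m$ or $\lambda_m$ inside such a multiset (or as the value of $\lambda_{\max}$, $\lambda_{\min}$) means the value $\lambda$ with multiplicity $m$; the multiplicities of equal values arising from different indices add up. $\lambda_{\max}(A)$ and $\lambda_{\min}(A)$ are the maximal and minimal eigenvalues. The multinomial coefficient is $\binom{n}{k_1\,\dots\,k_s}=\frac{n!}{k_1!\cdots k_s!\,(n-k_1-\dots-k_s)!}$. *)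

(* Defs.v *)
From HB Require Import structures.
From mathcomp Require Import all_boot all_order all_algebra.
From mathcomp Require Import zify classical_sets reals.

Set Implicit Arguments.
Unset Strict Implicit.
Unset Printing Implicit Defensive.

Import Order.TTheory GRing.Theory Num.Theory.
Local Open Scope ring_scope.

Record digraph := Digraph {
  vert :> finType;
  arrow : rel vert;
  arrow_irr : irreflexive arrow }.

Definition arrows (G : digraph) : {set G * G} := [set a | arrow a.1 a.2].

Definition connected (G : digraph) : Prop :=
  forall x y : G, connect [rel a b : G | arrow a b || arrow b a] x y.

Definition has_double_arrow (G : digraph) : Prop :=
  exists i j : G, [/\ i != j, arrow i j & arrow j i].

Definition has_triangle (G : digraph) : Prop :=
  exists i j k : G,
    [/\ uniq [:: i; j; k], arrow i j, arrow j k & arrow i k].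

Definition has_square (G : digraph) : Prop :=
  exists i j j' k : G,
    [/\ uniq [:: i; j; j'; k], arrow i j && arrow j k,
        arrow i j' && arrow j' k & ~~ arrow i k].

Section Box.
Variables X Y : digraph.

Definition box_arrow : rel (X * Y) := fun a b =>
  ((a.1 == b.1) && arrow a.2 b.2) || (arrow a.1 b.1 && (a.2 == b.2)).

Lemma box_irr : irreflexive box_arrow.
Proof. by move=> a; rewrite /box_arrow !arrow_irr andbF. Qed.

Definition box : digraph := Digraph box_irr.

End Box.

(* Cartesian power, meant for n >= 1 only: the value at n = 0 is also G. *)
Definition box_pow (G : digraph) (n : nat) : digraph :=
  iter n.-1 (fun H => box H G) G.

(* Throughout, paths are graded by their number q of vertices, not by their
   length p = q - 1.  In this way q = 0 gives the degree p = -1, where the space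
   of chains is {0}, and the boundary operator is given by the same formula in
   all degrees. *)
Section Chains.
Variables (R : realType) (G : digraph).

Definition regular (s : seq G) : bool := sorted [rel a b : G | a != b] s.
Definition allowed (s : seq G) : bool := sorted (@arrow G) s.

Definition rpath (q : nat) : finType :=
  {t : q.-tuple G | (0 < q)%N && regular t}.

Definition path_seq (q : nat) (t : rpath q) : seq G := val t.

(* [chain q] is the space R_p of the regular paths, p = q - 1. *)
Definition chain (q : nat) : vectType R := {ffun rpath q -> R^o}.

(* The basis symbol e_s; it is 0 when s is not a regular path on q vertices,
   q > 0, so that the non-regular terms of the boundary vanish. *)
Definition epath (q : nat) (s : seq G) : chain q :=
  [ffun t => (path_seq t == s)%:R].

Definition omit (k : nat) (s : seq G) : seq G := take k s ++ drop k.+1 s.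

Definition bd_fun (q : nat) (u : chain q.+1) : chain q :=
  \sum_(t : rpath q.+1)
    u t *: \sum_(k < q.+1) (-1) ^+ k *: epath q (omit k (path_seq t)).

Fact bd_fun_is_linear q : linear (@bd_fun q).
Proof.
move=> a u v; rewrite /bd_fun scaler_sumr -big_split /=; apply: eq_bigr => t _.
by rewrite !ffunE scalerDl scalerA.
Qed.

HB.instance Definition _ q :=
  GRing.isLinear.Build R (chain q.+1) (chain q) *:%R (@bd_fun q)
    (@bd_fun_is_linear q).

Definition bd (q : nat) : 'Hom(chain q.+1, chain q) := linfun (@bd_fun q).

Implicit Types s : seq G.

Lemma size_omit k s : (k < size s)%N -> size (omit k s) = (size s).-1.
Proof. by move=> h; rewrite size_cat size_take size_drop h; lia. Qed.

Lemma nth_omit x k s j : (k < size s)%N ->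
  nth x (omit k s) j = nth x s (bump k j).
Proof.
move=> h; rewrite nth_cat size_take h /bump; case: ltnP => jk.
  by rewrite nth_take.
by rewrite nth_drop; congr nth; lia.
Qed.

Lemma omitC s k l : (l < k)%N -> (k < size s)%N ->
  omit l (omit k s) = omit k.-1 (omit l s).
Proof.
move=> lk ks; have x : G by case: s ks.
have h1 : (l < size s)%N by lia.
have h2 : (l < size (omit k s))%N by rewrite (size_omit ks); lia.
have h3 : (k.-1 < size (omit l s))%N by rewrite (size_omit h1); lia.
apply: (@eq_from_nth _ x) => [|j _].
  by rewrite (size_omit h2) (size_omit h3) (size_omit ks) (size_omit h1).
rewrite (nth_omit _ _ h2) (nth_omit _ _ ks).
by rewrite (nth_omit _ _ h3) (nth_omit _ _ h1) /bump; congr nth; lia.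
Qed.

Lemma irregularP x s :
  ~~ regular s -> exists2 i, (i.+1 < size s)%N & nth x s i = nth x s i.+1.
Proof.
rewrite /regular => h.
suff: ~~ [forall i : 'I_(size s).-1, nth x s i != nth x s i.+1].
  case/forallPn=> i; rewrite negbK => /eqP e; exists i => //.
  by have := ltn_ord i; lia.
apply: contra h => /forallP h; apply/(sortedP x) => i hi.
have hi' : (i < (size s).-1)%N by lia.
exact: (h (Ordinal hi')).
Qed.

Lemma regular_nth x s i :
  (i.+1 < size s)%N -> nth x s i = nth x s i.+1 -> ~~ regular s.
Proof.
move=> hi e; apply/negP=> /(sortedP x) /(_ i hi) /=; by rewrite e eqxx.
Qed.

Lemma epath0 q s : ~~ regular s -> epath q s = 0.
Proof.
move=> h; apply/ffunP=> t; rewrite !ffunE.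
case: eqP => // e; case/negP: h; rewrite -e.
by case/andP: (valP t).
Qed.

Lemma bd_epath q s : size s = q.+1 ->
  bd q (epath q.+1 s) = \sum_(k < q.+1) (-1) ^+ k *: epath q (omit k s).
Proof.
move=> ss; rewrite lfunE /=.
case: (boolP (regular s)) => rs.
  have st : size s == q.+1 by apply/eqP.
  have tP : (0 < q.+1)%N && regular (Tuple st) by [].
  pose t : rpath q.+1 := exist _ (Tuple st) tP.
  rewrite /bd_fun (bigD1 t) //= [epath q.+1 s t]ffunE eqxx scale1r.
  rewrite [X in _ + X]big1 ?addr0 // => u ut; rewrite ffunE.
  case: eqP => [e|_]; last by rewrite scale0r.
  by case/eqP: ut; apply: val_inj; apply: val_inj.
rewrite epath0 // linear0; have x : G by case: (s) ss.
have [i hi e] := irregularP x rs.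
have hi1 : (i < q.+1)%N by lia.
have hi2 : (i.+1 < q.+1)%N by lia.
rewrite (bigD1 (Ordinal hi1)) //= (bigD1 (Ordinal hi2)) /=; last first.
  by rewrite -val_eqE /=; lia.
rewrite big1 => [|k /andP[]]; last first.
  rewrite -!val_eqE /= => h1 h2; have hk := ltn_ord k.
  rewrite epath0 ?scaler0 //.
  have ks : (k < size s)%N by lia.
  apply: (@regular_nth x _ (if (k < i)%N then i.-1 else i)).
    by rewrite size_omit // ss /=; case: ifP => ?; lia.
  rewrite !nth_omit // /bump; case: ifP => ki.
    have -> : ((k <= i.-1) + i.-1 = i)%N by lia.
    by have -> : ((k <= i.-1.+1) + i.-1.+1 = i.+1)%N by lia.
  have -> : ((k <= i) + i = i)%N by lia.
  by have -> : ((k <= i.+1) + i.+1 = i.+1)%N by lia.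
have -> : omit i.+1 s = omit i s.
  apply: (@eq_from_nth _ x); first by rewrite !size_omit //; lia.
  move=> j hj; rewrite !nth_omit //; [|lia..].
  rewrite /bump; case: (ltngtP i j) => ij; last by rewrite ?ij ?ltnn ?leqnn -?ij.
    by congr nth; lia.
  by congr nth; lia.
by rewrite exprS mulN1r scaleNr addr0 addrN.
Qed.

Lemma bd_bd q u : bd q (bd q.+1 u) = 0.
Proof.
rewrite [bd q.+1 _]lfunE /= linear_sum big1 // => t _.
rewrite linearZ linear_sum /=; set s := path_seq t.
have ss : size s = q.+2 by rewrite size_tuple.
rewrite (eq_bigr (fun k : 'I_q.+2 => \sum_(l < q.+1)
  (-1) ^+ (k + l) *: epath q (omit l (omit k s)))); last first.
  move=> k _; rewrite linearZ /= bd_epath ?size_omit ?ss // scaler_sumr.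
  by apply: eq_bigr => l _; rewrite scalerA exprD.
rewrite pair_bigA /= (bigID (fun p : 'I_q.+2 * 'I_q.+1 => (p.2 < p.1)%N)) /=.
rewrite [X in _ *: (X + _)](_ : _ = - (\sum_(p : 'I_q.+2 * 'I_q.+1 |
   ~~ (p.2 < p.1)%N) (-1) ^+ (p.1 + p.2) *:
     epath q (omit p.2 (omit p.1 s)))) ?addNr ?scaler0 //.
pose h (p : 'I_q.+2 * 'I_q.+1) : 'I_q.+2 * 'I_q.+1 :=
  (inord p.2.+1, inord p.1).
pose h' (p : 'I_q.+2 * 'I_q.+1) : 'I_q.+2 * 'I_q.+1 :=
  (inord p.2, inord p.1.-1).
rewrite (reindex_onto h h') => [|[k l] /= lk]; last first.
  have := ltn_ord k; have := ltn_ord l => h1 h2.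
  by congr pair; apply: val_inj; rewrite /= !inordK ?inord_val /= ?inordK //; lia.
rewrite -sumrN.
rewrite (eq_bigl (fun p : 'I_q.+2 * 'I_q.+1 => ~~ (p.2 < p.1)%N)) => [|[k l]];
  last first.
  rewrite /h /h' /=; have := ltn_ord k; have := ltn_ord l => h1 h2.
  rewrite (inordK (m := l.+1)) // xpair_eqE -!val_eqE /=.
  case: (ltnP k q.+1) => kq.
    by rewrite !inordK //=; lia.
  have -> : (l < k)%N by lia.
  apply/negP => /andP[_ /andP[/eqP h3 _]].
  have h4 := ltn_ord (inord k : 'I_q.+1).
  have := h3; rewrite inordK; lia.
apply: eq_bigr => [[k l]] /=; rewrite -leqNgt => kl.
have := ltn_ord k; have := ltn_ord l => h1 h2.
rewrite /h /= !inordK; [|lia..].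
rewrite omitC ?ss // addSn exprS mulN1r scaleNr /=.
by rewrite addnC.
Qed.

Definition Aspace (q : nat) : {vspace chain q} :=
  <<[seq epath q (path_seq t) | t <- enum (rpath q) & allowed (path_seq t)]>>%VS.

Definition Omega (q : nat) : {vspace chain q} :=
  match q with
  | 0 => 0%VS
  | q'.+1 => (Aspace q'.+1 :&: bd q' @^-1: Aspace q')%VS
  end.

Lemma bd_Omega q u : u \in Omega q.+1 -> bd q u \in Omega q.
Proof.
case: q u => [u _|q u] /=.
  rewrite memv0; apply/eqP/ffunP => t; by have := valP t.
rewrite memv_cap => /andP[_]; rewrite -memv_preim => h.
by rewrite memv_cap h -memv_preim bd_bd mem0v.
Qed.

(* Since bd maps Omega q.+1 into Omega q, the projection vsproj only changes
   the type of bd u here (see bdOmegaE). *)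
Definition bdOmega_fun (q : nat) (u : subvs_of (Omega q.+1)) :
  subvs_of (Omega q) := vsproj (Omega q) (bd q (vsval u)).

Fact bdOmega_fun_is_linear q : linear (@bdOmega_fun q).
Proof. by move=> a u v; rewrite /bdOmega_fun !linearP. Qed.

HB.instance Definition _ q :=
  GRing.isLinear.Build R (subvs_of (Omega q.+1)) (subvs_of (Omega q))
    *:%R (@bdOmega_fun q) (@bdOmega_fun_is_linear q).

Definition bdOmega (q : nat) :
    'Hom(subvs_of (Omega q.+1), subvs_of (Omega q)) :=
  linfun (@bdOmega_fun q).

Lemma bdOmegaE q (u : subvs_of (Omega q.+1)) :
  vsval (bdOmega q u) = bd q (vsval u).
Proof. by rewrite lfunE /= vsprojK // bd_Omega // subvsP. Qed.

Definition dotc (q : nat) (u v : chain q) : R := \sum_(t : rpath q) u t * v t.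

End Chains.

Section Adjoint.
Variable R : realType.

Definition inner_product (V : vectType R) (ip : V -> V -> R) : Prop :=
  [/\ forall u v, ip u v = ip v u,
      forall a u v w, ip (a *: u + v) w = a * ip u w + ip v w,
      forall u, 0 <= ip u u & forall u, ip u u = 0 -> u = 0].

Definition is_adjoint (U V : vectType R) (ipU : U -> U -> R) (ipV : V -> V -> R)
    (f : 'Hom(U, V)) (g : 'Hom(V, U)) : Prop :=
  forall u v, ipV (f u) v = ipU u (g v).

(* For inner products, the adjoint exists and is unique (adjointP,
   is_adjoint_uniq); the default value 0 is irrelevant. The forms used below
   are inner products by dotc_inner and ipOmega_inner. *)
Definition adjoint (U V : vectType R) (ipU : U -> U -> R) (ipV : V -> V -> R)
    (f : 'Hom(U, V)) : 'Hom(V, U) :=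
  xget 0 (is_adjoint ipU ipV f).

Lemma inner_product0l (V : vectType R) (ip : V -> V -> R) :
  inner_product ip -> forall w, ip 0 w = 0.
Proof.
case=> _ L _ _ w; move: (L 1 0 0 w); rewrite scale1r addr0 mul1r => /eqP.
by rewrite -subr_eq0 opprD addrA addrN sub0r oppr_eq0 => /eqP.
Qed.

Lemma is_adjoint_uniq (U V : vectType R) (ipU : U -> U -> R)
    (ipV : V -> V -> R) (f : 'Hom(U, V)) (g g' : 'Hom(V, U)) :
  inner_product ipU -> is_adjoint ipU ipV f g -> is_adjoint ipU ipV f g' ->
  g = g'.
Proof.
case=> C L P D hg hg'; apply/lfunP => v; apply/eqP; rewrite -subr_eq0.
apply/eqP/D; set w := g v - g' v.
have : ipU (g v) w = ipU (g' v) w by rewrite C -hg hg' C.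
have -> : g v = 1 *: w + g' v by rewrite scale1r addrNK.
by rewrite L mul1r => /eqP; rewrite -subr_eq0 addrK => /eqP.
Qed.

Lemma adjoint_ex (U V : vectType R) (ipU : U -> U -> R)
    (ipV : V -> V -> R) (f : 'Hom(U, V)) :
  inner_product ipU -> inner_product ipV -> exists g, is_adjoint ipU ipV f g.
Proof.
move=> hU hV; have z := inner_product0l hU; have z' := inner_product0l hV.
case: hU hV => C L P D [C' L' P' D'].
have [n [e eb]] : exists n, exists e : n.-tuple U, basis_of fullv e.
  by exists (\dim {: U}), (vbasis fullv); exact: vbasisP.
pose Phi_fun (u : U) : 'rV[R]_n := \row_i ipU u e`_i.
have Phi_lin : linear Phi_fun.
  by move=> a u v; apply/rowP=> i; rewrite !mxE L.
pose LPhi := GRing.isLinear.Build R U 'rV[R]_n *:%R Phi_fun Phi_lin.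
pose PhiL : {linear U -> 'rV[R]_n} := HB.pack Phi_fun LPhi.
pose Phi := linfun PhiL.
have ip_ext u w : (forall i : 'I_n, ipU u e`_i = ipU w e`_i) ->
   forall x, ipU u x = ipU w x.
  move=> h x; rewrite (coord_basis eb (memvf x)) ![ipU _ (\sum_i _)]C.
  elim/big_rec: _ => [|i y _ ih].
    by rewrite !z.
  by rewrite !L ih ![ipU e`_i _]C h.
have kPhi : lker Phi == 0%VS.
  apply/lker0P => u w; rewrite !lfunE /= => /rowP h.
  have h' (i : 'I_n) : ipU u e`_i = ipU w e`_i by have := h i; rewrite !mxE.
  apply/eqP; rewrite -subr_eq0; apply/eqP/D.
  have := ip_ext _ _ h' (u - w).
  have {1}-> : u = 1 *: (u - w) + w by rewrite scale1r addrNK.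
  by rewrite L mul1r => /eqP; rewrite -subr_eq0 addrK => /eqP.
have imPhi : limg Phi = fullv.
  apply/eqP; rewrite eqEdim subvf /= limg_dim_eq; last first.
    by rewrite (eqP kPhi) capv0.
  by rewrite (size_basis eb) dimvf dim_matrix mul1r.
pose Psi_fun (v : V) : 'rV[R]_n := \row_i ipV v (f e`_i).
have Psi_lin : linear Psi_fun.
  by move=> a u v; apply/rowP=> i; rewrite !mxE L'.
pose LPsi := GRing.isLinear.Build R V 'rV[R]_n *:%R Psi_fun Psi_lin.
pose PsiL : {linear V -> 'rV[R]_n} := HB.pack Psi_fun LPsi.
exists ((Phi^-1) \o linfun PsiL)%VF => u v.
rewrite comp_lfunE; set g := (Phi^-1)%VF _.
have hg : Phi g = PsiL v by rewrite limg_lfunVK ?imPhi ?memvf // lfunE.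
have hg' (i : 'I_n) : ipU g e`_i = ipV v (f e`_i).
  by move: hg; rewrite lfunE /= => /rowP/(_ i); rewrite !mxE.
rewrite C' C (coord_basis eb (memvf u)) linear_sum /=.
rewrite C' [RHS]C.
elim/big_ind2: _ => [|a b c d h1 h2|i _].
- by rewrite z z'.
- by rewrite -[b]scale1r -[a]scale1r L L' h1 h2.
by rewrite linearZ /= -[_ *: f _]addr0 -[_ *: e`_i]addr0 L L' z z' C' C hg'.
Qed.

Lemma adjointP (U V : vectType R) (ipU : U -> U -> R)
    (ipV : V -> V -> R) (f : 'Hom(U, V)) :
  inner_product ipU -> inner_product ipV ->
  is_adjoint ipU ipV f (adjoint ipU ipV f).
Proof. by move=> hU hV; apply: xgetPex; exact: adjoint_ex. Qed.

End Adjoint.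

Lemma dotc_inner (R : realType) (G : digraph) (q : nat) (c : R) :
  0 < c -> inner_product (fun u v : chain R G q => c * dotc u v).
Proof.
move=> c0; split=> [u v|a u v w|u|u].
- by congr (_ * _); apply: eq_bigr => t _; rewrite mulrC.
- rewrite mulrCA -mulrDr; congr (_ * _).
  rewrite /dotc mulr_sumr -big_split /=.
  by apply: eq_bigr => t _; rewrite !ffunE mulrDl mulrA.
- by apply: mulr_ge0; [exact: ltW | apply: sumr_ge0 => t _; rewrite -expr2 sqr_ge0].
move/eqP; rewrite mulf_eq0 gt_eqF //= psumr_eq0 => [/allP h|t _].
  apply/ffunP => t; have := h t (mem_index_enum t).
  by rewrite mulf_eq0 orbb ffunE => /eqP.
by rewrite -expr2 sqr_ge0.
Qed.

Section Hodge.
Variables (R : realType) (G : digraph).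
Variable ip : forall q : nat, chain R G q -> chain R G q -> R.

Definition ipOmega (q : nat) (u v : subvs_of (Omega R G q)) : R :=
  ip (vsval u) (vsval v).

Lemma ipOmega_inner (q : nat) :
  inner_product (@ip q) -> inner_product (@ipOmega q).
Proof.
case=> C L P D; rewrite /ipOmega; split=> [u v|a u v w|u|u h].
- exact: C.
- by rewrite linearP; exact: L.
- exact: P.
by apply: subvs_inj; rewrite linear0; exact: D.
Qed.

Definition bdOmega_adj (q : nat) :
    'Hom(subvs_of (Omega R G q), subvs_of (Omega R G q.+1)) :=
  adjoint (@ipOmega q.+1) (@ipOmega q) (bdOmega R G q).

(* The Hodge Laplacian on Omega_p, that is, on [Omega p.+1]. *)
Definition hodge (p : nat) : 'End(subvs_of (Omega R G p.+1)) :=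
  (bdOmega R G p.+1 \o bdOmega_adj p.+1)%VF
  + (bdOmega_adj p \o bdOmega R G p)%VF.

End Hodge.

Definition canonical_hodge (R : realType) (G : digraph) (p : nat) :
    'End(subvs_of (Omega R G p.+1)) :=
  hodge (@dotc R G) p.

(* The weight is 1 / p!, with p = q - 1 for paths on q vertices. *)
Definition normalized_hodge (R : realType) (G : digraph) (p : nat) :
    'End(subvs_of (Omega R G p.+1)) :=
  hodge (fun q (u v : chain R G q) => (q.-1)`!%:R^-1 * dotc u v) p.

Section Spectrum.
Variables (R : realType) (V : vectType R).

Definition mult (f : 'End(V)) (a : R) : nat := \dim (passmx.leigenspace f a).

(* The sequence s, up to order, is the multiset of the eigenvalues of the
   self-adjoint operator f, counted with multiplicity. *)
Definition is_spec (f : 'End(V)) (s : seq R) : Prop :=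
  forall a : R, count_mem a s = mult f a.

Definition is_lambda_max (f : 'End(V)) (a : R) (m : nat) : Prop :=
  [/\ passmx.leigenvalue f a,
      forall b, passmx.leigenvalue f b -> b <= a & mult f a = m].

Definition is_lambda_min (f : 'End(V)) (a : R) (m : nat) : Prop :=
  [/\ passmx.leigenvalue f a,
      forall b, passmx.leigenvalue f b -> a <= b & mult f a = m].

End Spectrum.

Definition multinom (n s : nat) (k : 'I_s -> nat) : nat :=
  (n`! %/ (\prod_(i < s) (k i)`! * (n - \sum_(i < s) k i)`!))%N.

(* The multiset of the (value k)_(mul k) for k_1, ..., k_s >= 0 such that
   r <= k_1 + ... + k_s <= n, as a sequence; the bound k_i <= n in the index type is implied. *)
Definition multiset_of (R : realType) (n s r : nat)
    (value : ('I_s -> nat) -> R) (mul : ('I_s -> nat) -> nat) : seq R :=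
  flatten
    [seq nseq (mul (fun i => k i : nat)) (value (fun i => k i : nat))
    | k : {ffun 'I_s -> 'I_n.+1} <- enum {ffun 'I_s -> 'I_n.+1}
      & (r <= \sum_(i < s) k i <= n)%N].

(* Main.v *)
From HB Require Import structures.
From mathcomp Require Import all_boot all_order all_algebra.
From mathcomp Require Import zify ring reals.
From mathcomp Require spectral mxred sesquilinear complex boolp.
Require Import Defs.

(** Work with coefficients: a chain u belongs to Omega exactly when it is
    supported on allowed paths and, for every pair a, b that is not an arrow,
    the coefficients of the paths obtained by inserting one vertex in a gap a b
    add up to zero (OmegaP).  A digraph without double arrow, triangle and
    square is thin: the gap left by two consecutive arrows can be filled in one
    way only.  Hence a thin digraph G has no chains in Omega beyond vertices
    and arrows, and its Laplacians in degrees 0 and 1 are B^T B and B B^T for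
    the incidence matrix B.  They are diagonalizable with the same nonzero
    eigenvalues; since G is connected, 0 is a simple eigenvalue of the first.
    The number of arrows then decides the kernel of the second: it has
    dimension 1 if there are as many arrows as vertices, and 0 if there is one
    arrow less (base_spectra).

    In a product of X with a thin factor Y, a gap at a corner of a lattice path
    has exactly two fillings, so coefficients change sign when a corner is
    flipped.  Flipping moves the steps in Y to the front of a path, and two
    adjacent steps in Y give coefficient zero.  So a chain in Omega of the
    product is determined by its coefficients on paths with at most one step in
    Y, placed in front, and it is a sum of cross products of chains in Omega of
    X with vertices and arrows of Y (Omega_box_ind).

    Cross products obey a product rule for the boundary, and the weights 1/p!
    make them multiplicative for the inner product: a path on q vertices
    crossed with an arrow is a signed sum of q distinct lattice paths.  Hence
    the coboundary obeys a product rule too, the mixed terms cancel in the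
    Laplacian, and products of eigenvectors are eigenvectors whose eigenvalues
    add up.  By induction, an eigenbasis in degree r of the n-th power chooses
    in each factor an eigenvector on vertices or on arrows, with r choices of
    the second kind (has_spec_pow).

    It remains to count the choices with a given sum.  If every vertex
    eigenvalue is also an arrow eigenvalue, the r positions of the arrows are
    arbitrary; if zero is not an arrow eigenvalue, they lie among the positions
    with nonzero eigenvalue.  The choices of nonzero eigenvalues are words in
    the alphabet of their indices, and the words of a given type are counted by
    multinomial coefficients (count_words, count_multiset).  The extremal
    eigenvalues arise from a single type, concentrated on one index. *)

Set Implicit Arguments.
Unset Strict Implicit.
Unset Printing Implicit Defensive.

Import Order.TTheory GRing.Theory Num.Theory.
Local Open Scope ring_scope.

(** * Coefficients of chains, and the local conditions that define Omega *)

Lemma sum_pair (V : nmodType) (I J : finType) (F : I * J -> V) :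
  \sum_p F p = \sum_i \sum_j F (i, j).
Proof. by rewrite pair_bigA /=; apply: eq_bigr => -[]. Qed.

Section Coefficients.
Variables (R : realType) (G : digraph).
Implicit Types (s y : seq G).

(** Coefficients are read off at arbitrary sequences, with value 0 at those
    that are not regular paths on q vertices, so that cutting and gluing paths
    needs no regularity proofs. *)
Definition pcoef q (u : chain R G q) s : R := dotc u (epath R q s).

Lemma dotc_linearl q a (u v w : chain R G q) :
  dotc (a *: u + v) w = a * dotc u w + dotc v w.
Proof.
rewrite /dotc mulr_sumr -big_split; apply: eq_bigr => t _ /=.
by rewrite !ffunE mulrDl mulrA.
Qed.

Lemma dotcC q (u v : chain R G q) : dotc u v = dotc v u.
Proof. by apply: eq_bigr => t _; rewrite mulrC. Qed.

Lemma dotc_linearr q a (u v w : chain R G q) :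
  dotc w (a *: u + v) = a * dotc w u + dotc w v.
Proof. by rewrite dotcC dotc_linearl !(dotcC _ w). Qed.

Lemma dotc_sumr q (I : Type) (r : seq I) (P : pred I) (a : I -> R)
    (e : I -> chain R G q) w :
  dotc w (\sum_(i <- r | P i) a i *: e i) = \sum_(i <- r | P i) a i * dotc w (e i).
Proof.
elim/big_rec2: _ => [|i x v _ <-]; last by rewrite dotc_linearr.
by rewrite /dotc big1 // => t _; rewrite ffunE mulr0.
Qed.

Lemma dotc_suml q (I : Type) (r : seq I) (P : pred I) (a : I -> R)
    (e : I -> chain R G q) w :
  dotc (\sum_(i <- r | P i) a i *: e i) w = \sum_(i <- r | P i) a i * dotc (e i) w.
Proof. by rewrite dotcC dotc_sumr; apply: eq_bigr => i _; rewrite dotcC. Qed.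

Lemma pcoefE q (u : chain R G q) t : pcoef u (path_seq t) = u t.
Proof.
rewrite /pcoef /dotc (bigD1 t) //= ffunE eqxx mulr1 big1 ?addr0 // => t' nt.
rewrite ffunE; case: eqP => [e|_]; last by rewrite mulr0.
by case/eqP: nt; apply: val_inj; apply: val_inj.
Qed.

Variant path_spec q s : bool -> Prop :=
  | IsPath (t : rpath G q) of s = path_seq t : path_spec q s true
  | IsNotPath of (forall t : rpath G q, path_seq t != s) : path_spec q s false.

Lemma pathP q s : path_spec q s [&& size s == q, (0 < q)%N & regular s].
Proof.
case: (boolP [&& _, _ & _]) => [/and3P[h h0 h1]|h].
  have tP : (0 < q)%N && regular (Tuple h) by rewrite h0.
  exact: (@IsPath _ _ (exist _ (Tuple h) tP)).
apply: IsNotPath => t; apply: contra h => /eqP <-.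
by rewrite /path_seq size_tuple eqxx; exact: (valP t).
Qed.

Lemma rpathP q (t : rpath G q) :
  [&& size (path_seq t) == q, (0 < q)%N & regular (path_seq t)].
Proof. by rewrite size_tuple eqxx; exact: (valP t). Qed.

Lemma epath_eq0 q s : ~~ [&& size s == q, (0 < q)%N & regular s] ->
  epath R q s = 0.
Proof.
case: pathP => // h _; apply/ffunP => t; rewrite !ffunE.
by rewrite (negbTE (h t)).
Qed.

Lemma pcoef_notpath q (u : chain R G q) s :
  ~~ [&& size s == q, (0 < q)%N & regular s] -> pcoef u s = 0.
Proof.
by move=> h; rewrite /pcoef epath_eq0 // /dotc big1 // => t _; rewrite ffunE mulr0.
Qed.

Lemma pcoef_epath q s s' :
  pcoef (epath R q s) s' = ([&& size s == q, (0 < q)%N & regular s] && (s == s'))%:R.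
Proof.
case: (pathP q s') => [t ->|h].
  rewrite pcoefE ffunE eq_sym; case: eqP => [->|_]; last by rewrite andbF.
  by rewrite rpathP.
case: (pathP q s) => [t e|h'] /=; last first.
  rewrite /pcoef /dotc big1 // => t _.
  by rewrite !ffunE (negbTE (h' t)) mul0r.
have -> : (s == s') = false by apply: contraNF (h t) => /eqP <-; rewrite e.
rewrite e.
rewrite /pcoef /dotc big1 // => t' _; by rewrite !ffunE (negbTE (h t')) mulr0.
Qed.

Lemma pcoef_linear q a (u v : chain R G q) s :
  pcoef (a *: u + v) s = a * pcoef u s + pcoef v s.
Proof. exact: dotc_linearl. Qed.

Lemma pcoef_comb q (I : Type) (r : seq I) (P : pred I) (a : I -> R)
    (e : I -> chain R G q) s :
  pcoef (\sum_(i <- r | P i) a i *: e i) s = \sum_(i <- r | P i) a i * pcoef (e i) s.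
Proof. exact: dotc_suml. Qed.

Lemma pcoef0 q s : pcoef (0 : chain R G q) s = 0.
Proof. by rewrite /pcoef /dotc big1 // => t _; rewrite ffunE mul0r. Qed.

Lemma chain_ext q (u v : chain R G q) : (forall s, pcoef u s = pcoef v s) -> u = v.
Proof. by move=> h; apply/ffunP => t; rewrite -!pcoefE. Qed.

Lemma chain_decomp q (u : chain R G q) :
  u = \sum_(t : rpath G q) u t *: epath R q (path_seq t).
Proof.
apply/ffunP => t; rewrite sum_ffunE (bigD1 t) //= !ffunE eqxx.
rewrite [_ *: _]mulr1 big1 ?addr0 // => t' nt; rewrite !ffunE.
case: eqP => [e|_]; last by rewrite scaler0.
by case/eqP: nt; apply: val_inj; apply: val_inj.
Qed.

Lemma chain_ind q (P : chain R G q -> Prop) :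
  P 0 -> (forall a u v, P u -> P v -> P (a *: u + v)) ->
  (forall s, size s = q -> (0 < q)%N -> regular s -> P (epath R q s)) ->
  forall u, P u.
Proof.
move=> P0 PD Pe u; rewrite (chain_decomp u); elim/big_ind: _ => // [v w|t _].
  by move=> hv hw; rewrite -[v]scale1r; exact: PD.
rewrite -[_ *: _]addr0; apply: PD => //.
by have /and3P[/eqP ? ? ?] := rpathP t; exact: Pe.
Qed.

Lemma chain_deg0 (u : chain R G 0) : u = 0.
Proof. by apply: chain_ext => s; rewrite !pcoef_notpath // andbF. Qed.

Lemma allowed_regular s : allowed s -> regular s.
Proof.
apply: sub_sorted => x y /=; apply: contraTneq => ->.
by rewrite arrow_irr.
Qed.

Lemma AspaceP q (u : chain R G q) :
  reflect (forall s, ~~ allowed s -> pcoef u s = 0) (u \in Aspace R G q).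
Proof.
apply: (iffP idP) => [uA s sN|h].
  set X := [seq epath R q (path_seq t) | t <- enum (rpath G q)
              & allowed (path_seq t)].
  have /coord_span -> : u \in <<in_tuple X>>%VS by [].
  rewrite pcoef_comb big1 // => i _.
  have : X`_i \in X by rewrite mem_nth.
  case/mapP => t; rewrite mem_filter => /andP[tA _] ->.
  rewrite pcoef_epath; case: (path_seq t =P s) => [e|_]; last by rewrite andbF mulr0.
  by rewrite -e tA in sN.
rewrite (chain_decomp u); apply: memv_suml => t _.
case: (boolP (allowed (path_seq t))) => tA.
  apply: memvZ; apply: memv_span; apply/mapP; exists t => //.
  by rewrite mem_filter tA mem_enum.
by rewrite -pcoefE h // scale0r mem0v.
Qed.

Lemma OmegaS q (u : chain R G q.+1) :
  (u \in Omega R G q.+1) = (u \in Aspace R G q.+1) && (bd R G q u \in Aspace R G q).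
Proof. by rewrite /Omega memv_cap memv_preim. Qed.

Lemma omit_cat y1 m y2 : omit (size y1) (y1 ++ m :: y2) = y1 ++ y2.
Proof.
rewrite /omit take_size_cat //; congr cat.
by rewrite drop_cat ltnNge leqnSn /= subSnn /= drop0.
Qed.

Lemma omit_catr k y1 y2 : (size y1 <= k)%N ->
  omit k (y1 ++ y2) = y1 ++ omit (k - size y1) y2.
Proof.
move=> h; rewrite /omit take_cat drop_cat ltnNge h /= ltnNge leqW //= -catA.
by rewrite subSn.
Qed.

Lemma omit_catl k y1 y2 : (k < size y1)%N ->
  omit k (y1 ++ y2) = omit k y1 ++ y2.
Proof.
move=> h; rewrite /omit take_cat drop_cat h -catA; congr cat.
case: (ltnP k.+1 (size y1)) => // h2; have -> : k.+1 = size y1 by lia.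
by rewrite drop_size subnn drop0.
Qed.

Lemma allowed_cat2 y1 (a b : G) y2 : allowed (y1 ++ a :: b :: y2) -> arrow a b.
Proof.
rewrite /allowed; case: y1 => [|c y1] /=; first by case/andP.
by rewrite cat_path /= => /and3P[_ _ /andP[]].
Qed.

(** Away from the omitted vertex, consecutive vertices of t stay
    consecutive; so the gap a b can only come from a vertex omitted between a
    and b. *)
Lemma omit_gap t k y1 (a b : G) y2 : (k < size t)%N ->
  allowed t -> ~~ arrow a b -> omit k t = y1 ++ a :: b :: y2 ->
  exists2 m, t = y1 ++ a :: m :: b :: y2 & k = (size y1).+1.
Proof.
move=> kt tA nab e.
have [x tE] : exists x, t = take k t ++ x :: drop k.+1 t.
  exists (nth a t k); rewrite -drop_nth //; by rewrite cat_take_drop.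
have sk : size (take k t) = k by rewrite size_takel // ltnW.
case: (ltngtP k (size y1).+1) => h; last first.
- exists x => //; rewrite {1}tE; move: e; rewrite /omit.
  rewrite -[y1 ++ _]/(y1 ++ [:: a] ++ b :: y2) catA => /eqP.
  rewrite eqseq_cat; last by rewrite size_cat sk /= addn1.
  by case/andP=> /eqP -> /eqP ->; rewrite -catA.
- case/negP: nab.
  have : take (size y1).+2 (omit k t) = y1 ++ [:: a; b].
    by rewrite e take_cat ltnNge leqW //= subSn // subSn // subnn /= take0.
  rewrite /omit take_cat sk.
  move: h; rewrite leq_eqVlt => /orP[/eqP h|h].
    rewrite -h ltnn subnn take0 cats0 => e'.
    by move: tA; rewrite tE -h e' -catA /= => /allowed_cat2.
  rewrite h => e'; move: tA; rewrite tE.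
  rewrite -(cat_take_drop (size y1).+2 (take k t)) e' -!catA /=.
  by move/allowed_cat2.
case/negP: nab.
have : drop k (omit k t) = drop k (y1 ++ a :: b :: y2) by rewrite e.
rewrite /omit drop_size_cat // drop_cat.
move: h; rewrite ltnS leq_eqVlt => /orP[/eqP h|h].
  rewrite h ltnn subnn drop0 => e'.
  by move: tA; rewrite tE h e' -cat_rcons => /allowed_cat2.
rewrite h => e'; move: tA; rewrite tE e' -cat_rcons catA.
by move/allowed_cat2.
Qed.

Lemma pcoef_bd q (w : chain R G q.+1) y :
  pcoef (bd R G q w) y = \sum_(t : rpath G q.+1) w t *
     \sum_(k < q.+1) (-1) ^+ k * pcoef (epath R q (omit k (path_seq t))) y.
Proof.
rewrite [bd _ _ _ _]lfunE /= /bd_fun pcoef_comb; apply: eq_bigr => t _.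
by rewrite pcoef_comb.
Qed.

(** By omit_gap, only insertions in the gap a b contribute, and all of them
    with the same sign.  This turns the vanishing of a boundary coefficient
    into a linear condition without signs. *)
Lemma pcoef_bd_gap q (w : chain R G q.+1) y1 a b y2 : w \in Aspace R G q.+1 ->
  ~~ arrow a b -> a != b ->
  pcoef (bd R G q w) (y1 ++ a :: b :: y2) =
  [&& size (y1 ++ a :: b :: y2) == q, (0 < q)%N & regular (y1 ++ a :: b :: y2)]%:R
   * (-1) ^+ (size y1).+1 * \sum_m pcoef w (y1 ++ a :: m :: b :: y2).
Proof.
move=> wA nab ab; set y := y1 ++ a :: b :: y2.
case: (pathP q y) => [t0 ty|]; last first.
  move=> h; rewrite !mul0r pcoef_notpath //; case: pathP h => // t e /(_ t).
  by rewrite e eqxx.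
have ry := rpathP t0; rewrite -ty in ry.
have {t0 ty}sy : size y = q by case/andP: ry => /eqP.
rewrite mul1r mulr_sumr pcoef_bd.
pose F m (t : rpath G q.+1) := (path_seq t == y1 ++ a :: m :: b :: y2).
transitivity (\sum_(t : rpath G q.+1) w t *
    (\sum_m (-1) ^+ (size y1).+1 * (F m t)%:R)).
  apply: eq_bigr => t _.
  case: (boolP (allowed (path_seq t))) => tA; last first.
    by rewrite -pcoefE (AspaceP _ wA) // !mul0r.
  congr (_ * _).
  have st : size (path_seq t) = q.+1 by rewrite size_tuple.
  have rl k (z := omit k (path_seq t)) :
      [&& size z == q, (0 < q)%N & regular z] && (z == y) = (z == y).
    by case: (_ =P y) => [->|_]; rewrite ?andbF // ry.
  transitivity (\sum_(k < q.+1) (-1)^+k * (omit k (path_seq t) == y)%:R : R).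
    by apply: eq_bigr => k _; rewrite pcoef_epath rl.
  case: (boolP [exists m, F m t]) => [/existsP[m /eqP e]|/existsPn h]; last first.
    rewrite !big1 // => [m _|k _].
      by rewrite (negbTE (h m)) mulr0.
    case: eqP => [e|_]; last by rewrite mulr0.
    have kt : (k < size (path_seq t))%N by rewrite st.
    have [m e' _] := omit_gap kt tA nab e.
    by move: (h m); rewrite /F e' eqxx.
  have hk : ((size y1).+1 < q.+1)%N.
    by rewrite -sy /y size_cat /= addnS addnS; lia.
  have om : omit (size y1).+1 (y1 ++ a :: m :: b :: y2) = y.
    rewrite -cat1s catA -[(size y1).+1]addn1 -[1%N]/(size [:: a]) -size_cat.
    by rewrite omit_cat -catA.
  rewrite (bigD1 (Ordinal hk)) //= e om eqxx mulr1.
  rewrite [RHS](bigD1 m) //= /F e eqxx mulr1 !big1 ?addr0 // => [m' nm|k nk].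
    case: eqP => [e2|_]; last by rewrite mulr0.
    move/eqP: e2; rewrite eqseq_cat // => /andP[_ /eqP[e2]].
    by rewrite e2 eqxx in nm.
  case: eqP => [e2|_]; last by rewrite mulr0.
  rewrite -e in e2.
  have kt : (k < size (path_seq t))%N by rewrite st.
  have [m' _ e3] := omit_gap kt tA nab e2.
  by case/eqP: nk; apply: val_inj.
transitivity (\sum_(t : rpath G q.+1) \sum_m (-1) ^+ (size y1).+1 * (w t * (F m t)%:R)).
  by apply: eq_bigr => t _; rewrite mulr_sumr; apply: eq_bigr => m _; rewrite mulrCA.
rewrite exchange_big /=; apply: eq_bigr => m _; rewrite -mulr_sumr; congr (_ * _).
by apply: eq_bigr => t _; rewrite ffunE.
Qed.

Lemma nonallowed_split s : ~~ allowed s ->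
  exists y1 a b y2, s = y1 ++ a :: b :: y2 /\ ~~ arrow a b.
Proof.
rewrite /allowed; case: s => [//|x s] /=.
elim: s x => [//|z s ih] x /=; rewrite negb_and => /orP[h|/ih].
  by exists [::], x, z, s.
by case=> [y1 [a [b [y2 [-> h]]]]]; exists (x :: y1), a, b, y2.
Qed.

Lemma regular_cat2 y1 (a b : G) y2 : regular (y1 ++ a :: b :: y2) -> a != b.
Proof.
rewrite /regular; case: y1 => [|c y1] /=; first by case/andP.
by rewrite cat_path /= => /and3P[_ _ /andP[]].
Qed.

Lemma regular_of_insertion (y1 : seq G) a m b y2 : allowed (y1 ++ a :: m :: b :: y2) ->
  a != b -> regular (y1 ++ a :: b :: y2).
Proof.
move=> /allowed_regular; rewrite /regular; case: y1 => [|c y1] /=.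
  by move=> /and3P[_ _ ->] ->.
by rewrite !cat_path /= => /and5P[-> -> _ _ ->] ->.
Qed.

(** The boundary condition is local: one equation for each gap a b that is
    not an arrow.  Regularity of the remaining vertices need not be required,
    since all insertions in an irregular rest have coefficient 0. *)
Lemma OmegaP q (w : chain R G q.+1) :
  reflect ((forall s, ~~ allowed s -> pcoef w s = 0) /\
     (forall y1 a b y2, ~~ arrow a b -> a != b ->
        \sum_m pcoef w (y1 ++ a :: m :: b :: y2) = 0))
    (w \in Omega R G q.+1).
Proof.
rewrite OmegaS; apply: (iffP andP) => [[wA /AspaceP bA]|[wA h]]; split.
- exact/AspaceP.
- move=> y1 a b y2 nab ab.
  have : pcoef (bd R G q w) (y1 ++ a :: b :: y2) = 0.
    by apply: bA; apply: contra nab; exact: allowed_cat2.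
  rewrite pcoef_bd_gap //; case: (boolP [&& _, _ & _]) => [_|ny _].
    by rewrite mul1r => /eqP; rewrite mulf_eq0 signr_eq0 => /eqP.
  rewrite big1 // => m _.
  case: (boolP (allowed (y1 ++ a :: m :: b :: y2))) => al; last first.
    exact: (AspaceP _ wA).
  apply: pcoef_notpath; apply: contra ny => /and3P[sz _ _].
  rewrite (regular_of_insertion al ab) andbT; move: sz; rewrite !size_cat /=; lia.
- exact/AspaceP.
- apply/AspaceP => y /nonallowed_split[y1 [a [b [y2 [-> nab]]]]].
  case: (eqVneq a b) => [ab|ab].
    apply: pcoef_notpath; rewrite negb_and negb_and; apply/orP; right; apply/orP; right.
    by apply/negP => /regular_cat2; rewrite ab eqxx.
  by rewrite pcoef_bd_gap //; [rewrite h // mulr0|exact/AspaceP].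
Qed.

Lemma pcoefD q (u v : chain R G q) s : pcoef (u + v) s = pcoef u s + pcoef v s.
Proof. by rewrite -[u in LHS]scale1r pcoef_linear mul1r. Qed.

Lemma pcoefB q (u v : chain R G q) s : pcoef (u - v) s = pcoef u s - pcoef v s.
Proof. by rewrite addrC -scaleN1r pcoef_linear mulN1r addrC. Qed.

Lemma pcoef_sum q (I : Type) (r : seq I) (P : pred I)
    (e : I -> chain R G q) s :
  pcoef (\sum_(i <- r | P i) e i) s = \sum_(i <- r | P i) pcoef (e i) s.
Proof. by elim/big_rec2: _ => [|i x v _ <-]; rewrite ?pcoef0 ?pcoefD. Qed.

Lemma dotc0l q (u : chain R G q) : dotc 0 u = 0.
Proof. by rewrite /dotc big1 // => t _; rewrite ffunE mul0r. Qed.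

End Coefficients.

(** * Lattice paths in a Cartesian product *)

Section Linear.
Variables (K : nzRingType) (U V : lmodType K) (h : U -> V).
Hypothesis hl : linear h.

Lemma linear_0 : h 0 = 0.
Proof. by have := hl (-1) 0 0; rewrite scaleN1r oppr0 addr0 scaleN1r addNr. Qed.

Lemma linear_Z a u : h (a *: u) = a *: h u.
Proof. by rewrite -[_ *: u]addr0 hl linear_0 addr0. Qed.

Lemma linear_D u v : h (u + v) = h u + h v.
Proof. by rewrite -[u in LHS]scale1r hl scale1r. Qed.

Lemma linear_B u v : h (u - v) = h u - h v.
Proof. by rewrite linear_D -scaleN1r linear_Z scaleN1r. Qed.

Lemma linear_comb (I : Type) (r : seq I) (P : pred I) (a : I -> K) (e : I -> U) :
  h (\sum_(i <- r | P i) a i *: e i) = \sum_(i <- r | P i) a i *: h (e i).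
Proof. by elim/big_rec2: _ => [|i x v _ <-]; [exact: linear_0 | exact: hl]. Qed.

End Linear.

Section Sorted.
Variables (T : Type) (e : rel T).

Lemma sorted_cat1 s1 x s2 :
  sorted e (s1 ++ x :: s2) = sorted e (rcons s1 x) && sorted e (x :: s2).
Proof.
by case: s1 => [|y s1] //=; rewrite cat_path rcons_path /= andbA.
Qed.

Lemma sorted_cat2 s1 x y s2 : sorted e (rcons s1 x ++ y :: s2) =
  [&& sorted e (rcons s1 x), e x y & sorted e (y :: s2)].
Proof. by rewrite cat_rcons sorted_cat1 /=. Qed.

End Sorted.

Section Omit.
Variable X : digraph.
Implicit Type s : seq X.

Lemma take_omit k j s : (k < j)%N -> take j (omit k s) = omit k (take j.+1 s).
Proof.
move=> kj; case: (ltnP k (size s)) => ks; last first.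
  have os : omit k s = s.
    by rewrite /omit take_oversize // drop_oversize ?cats0 // leqW.
  by rewrite os !take_oversize ?os //; lia.
rewrite /omit take_takel; last by lia.
rewrite take_cat size_take ks ltnNge (ltnW kj) /= take_drop.
by congr (_ ++ drop _ (take _ _)); lia.
Qed.

Lemma drop_omit k j s : (k <= j)%N -> (k < size s)%N ->
  drop j (omit k s) = drop j.+1 s.
Proof.
move=> kj ks; rewrite /omit drop_cat size_take ks ltnNge kj /= drop_drop.
by congr drop; lia.
Qed.

Lemma take_omit_le k j s : (j <= k)%N -> (k < size s)%N ->
  take j (omit k s) = take j s.
Proof.
move=> jk ks; rewrite /omit take_cat size_take ks.
case: (ltnP j k) => h; first by rewrite take_takel // ltnW.
have -> : j = k by lia.
by rewrite subnn take0 cats0.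
Qed.

Lemma drop_omit_le k j s : (j <= k)%N -> (k < size s)%N ->
  drop j (omit k s) = omit (k - j) (drop j s).
Proof.
move=> jk ks; rewrite /omit drop_cat size_take ks.
case: (ltnP j k) => h.
  by rewrite take_drop drop_drop; congr (drop _ (take _ _) ++ drop _ _); lia.
have -> : j = k by lia.
by rewrite subnn take0 !drop_drop /=; congr drop; lia.
Qed.

End Omit.

Lemma omit_map (X Y : digraph) (h : X -> Y) k s :
  omit k (map h s) = map h (omit k s).
Proof. by rewrite /omit map_cat map_take map_drop. Qed.

Section Lattice.
Variables (X Y : digraph).
Implicit Types (s : seq X) (v w : Y).

Definition stack s v : seq (box X Y) := [seq (x, v) | x <- s].

(** The lattice path that follows s at height v up to its vertex number j,
    climbs to height w, and follows the rest of s there. *)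
Definition elevate j s v w : seq (box X Y) :=
  stack (take j.+1 s) v ++ stack (drop j s) w.

(** What is left of an elevated path when an end of its vertical step is
    omitted: strictly inside s, the path changes height along a diagonal. *)
Definition jump j s v w : seq (box X Y) :=
  stack (take j s) v ++ stack (drop j s) w.

Lemma size_stack s v : size (stack s v) = size s.
Proof. exact: size_map. Qed.

Lemma size_elevate j s v w : (j < size s)%N ->
  size (elevate j s v w) = (size s).+1.
Proof.
by move=> h; rewrite size_cat !size_stack size_drop size_takel //; lia.
Qed.

Lemma regular_stack s v : regular (stack s v) = regular s.
Proof.
rewrite /regular /stack sorted_map; apply: eq_sorted => x y /=.
by rewrite xpair_eqE eqxx andbT.
Qed.

Lemma allowed_stack s v : allowed (stack s v) = allowed s.
Proof.
rewrite /allowed /stack sorted_map; apply: eq_sorted => x y /=.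
by rewrite /box_arrow /= arrow_irr eqxx andbF andbT.
Qed.

Lemma stack_inj s s' v v' : (0 < size s)%N ->
  (stack s v == stack s' v') = (s == s') && (v == v').
Proof.
case: s => // x s _; apply/eqP/andP => [|[/eqP -> /eqP -> //]].
case: s' => // x' s' [-> -> /(congr1 (map fst))]; rewrite -!map_comp !map_id.
by move=> ->.
Qed.

Lemma map_snd_elevate j s v w :
  map snd (elevate j s v w) =
  nseq (size (take j.+1 s)) v ++ nseq (size (drop j s)) w.
Proof.
rewrite map_cat; congr (_ ++ _); rewrite -map_comp.
  by elim: (take _ _) => //= x r ->.
by elim: (drop _ _) => //= x r ->.
Qed.

Lemma elevate_split s1 x s2 v w :
  elevate (size s1) (s1 ++ x :: s2) v w = stack (rcons s1 x) v ++ stack (x :: s2) w.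
Proof.
rewrite /elevate drop_size_cat // -cat_rcons take_size_cat ?size_rcons //.
Qed.

Lemma split_at j s : (j < size s)%N ->
  exists s1 x s2, s = s1 ++ x :: s2 /\ j = size s1.
Proof.
case: s => [//|y s] h; exists (take j (y :: s)), (nth y (y :: s) j), (drop j.+1 (y :: s)).
by rewrite -drop_nth // cat_take_drop size_takel // ltnW.
Qed.

Lemma stack_rcons s x v : stack (rcons s x) v = rcons (stack s v) (x, v).
Proof. exact: map_rcons. Qed.

Lemma regular_elevate j s v w : (j < size s)%N -> v != w ->
  regular (elevate j s v w) = regular s.
Proof.
move=> /split_at [s1 [x [s2 [-> ->]]]] vw; rewrite elevate_split.
rewrite /regular [sorted _ (s1 ++ _)]sorted_cat1 stack_rcons [stack (_ :: _) _]/=.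
rewrite sorted_cat2 -stack_rcons.
have := regular_stack (rcons s1 x) v; rewrite /regular => ->.
have := regular_stack (x :: s2) w; rewrite /regular => ->.
by rewrite /= xpair_eqE (negbTE vw) andbF.
Qed.

Lemma allowed_elevate j s v w : (j < size s)%N ->
  allowed (elevate j s v w) = allowed s && arrow v w.
Proof.
move=> /split_at [s1 [x [s2 [-> ->]]]]; rewrite elevate_split.
rewrite /allowed [sorted _ (s1 ++ _)]sorted_cat1 stack_rcons [stack (_ :: _) _]/=.
rewrite sorted_cat2 -stack_rcons.
have := allowed_stack (rcons s1 x) v; rewrite /allowed => ->.
have := allowed_stack (x :: s2) w; rewrite /allowed => ->.
by rewrite /= /box_arrow /= eqxx arrow_irr orbF /= andbA andbAC.
Qed.

(** The second components show v, w and j; the first components of the two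
    parts then overlap in one vertex and give back s. *)
Lemma elevate_inj j s v w j' s' v' w' :
  (j < size s)%N -> (j' < size s')%N -> size s = size s' -> v != w -> v' != w' ->
  (elevate j s v w == elevate j' s' v' w') =
  [&& j == j', s == s', v == v' & w == w'].
Proof.
move=> js js' ss vw vw'; apply/eqP/and4P; last first.
  by case=> /eqP -> /eqP -> /eqP -> /eqP ->.
move=> e; have v0 : v = v'.
  case: s js e {ss} => // x s _; case: s' js' => // x' s' _ /=.
  by rewrite /elevate /= => -[].
have es := congr1 (map snd) e; rewrite !map_snd_elevate in es.
rewrite -v0 in es e vw' *.
have ej : j = j'.
  have := congr1 (count_mem v) es; rewrite !count_cat !count_nseq /= !eqxx.
  rewrite [w == v]eq_sym [w' == v]eq_sym (negbTE vw) (negbTE vw') !mul1n !addn0.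
  by rewrite !size_takel //; lia.
rewrite -ej in js' es e *.
move/eqP: es; rewrite eqseq_cat; last by rewrite !size_nseq !size_takel.
case/andP=> _; rewrite !size_drop -ss -{1}(subnSK js) -{1}(subnSK js) /=.
case/andP=> /eqP ew _; rewrite -ew in e *; rewrite !eqxx.
split=> //; apply/eqP.
move/eqP: e; rewrite /elevate eqseq_cat; last by rewrite !size_stack !size_takel.
case/andP=> /eqP e1 /eqP e2.
have f1 : injective (fun x : X => (x, v) : box X Y) by move=> ? ? [].
have f2 : injective (fun x : X => (x, w) : box X Y) by move=> ? ? [].
move/(inj_map f1): e1 => e1; move/(inj_map f2): e2 => e2.
rewrite -(cat_take_drop j s) -(cat_take_drop j s') e2; congr (_ ++ _).
by rewrite -(@take_takel _ j j.+1) // e1 take_takel.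
Qed.

Lemma stack_elevate s v j s' v' w' : (j < size s')%N -> v' != w' ->
  stack s v != elevate j s' v' w'.
Proof.
move=> js /negP vw; apply/negP => /eqP e; case: vw.
have h z : z \in stack s v -> z.2 = v by case/mapP => ? _ ->.
have mem x : (x, v') \in elevate j s' v' w' -> v' = v by rewrite -e => /h.
have mem' x : (x, w') \in elevate j s' v' w' -> w' = v by rewrite -e => /h.
have [s1 [x [s2 [es ej]]]] := split_at js.
have e1 : v' = v.
  apply: (mem x); rewrite es ej elevate_split mem_cat stack_rcons.
  by rewrite mem_rcons inE eqxx.
have e2 : w' = v.
  apply: (mem' x); rewrite es ej elevate_split mem_cat.
  by rewrite [_ \in stack (_ :: _) _]inE eqxx orbT.
by rewrite e1 e2.
Qed.

Lemma omit_elevate_lt k j s v w : (k < j)%N -> (j < size s)%N ->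
  omit k (elevate j s v w) = elevate j.-1 (omit k s) v w.
Proof.
move=> kj js; have j0 : j.-1.+1 = j by lia.
rewrite /elevate omit_catl; last by rewrite size_stack size_takel //; lia.
rewrite [omit k (stack _ _)]omit_map j0 take_omit // drop_omit //; last by lia.
  by rewrite j0.
by lia.
Qed.

Lemma omit_elevate_gt k j s v w : (j.+1 < k)%N -> (k <= size s)%N ->
  omit k (elevate j s v w) = elevate j (omit k.-1 s) v w.
Proof.
move=> kj js; rewrite /elevate omit_catr; last by rewrite size_stack size_takel //; lia.
rewrite size_stack size_takel; last by lia.
rewrite [omit _ (stack _ _)]omit_map take_omit_le; try lia.
rewrite drop_omit_le; try lia.
by congr (_ ++ stack (omit _ _) _); lia.
Qed.

Lemma omit_elevate_l j s v w : (j < size s)%N ->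
  omit j (elevate j s v w) = jump j s v w.
Proof.
move=> js; rewrite /elevate omit_catl; last by rewrite size_stack size_takel.
by rewrite [omit _ (stack _ _)]omit_map /omit take_takel //
  drop_oversize ?cats0 // size_takel.
Qed.

Lemma omit_elevate_r j s v w : (j < size s)%N ->
  omit j.+1 (elevate j s v w) = jump j.+1 s v w.
Proof.
move=> js; rewrite /elevate omit_catr; last by rewrite size_stack size_takel.
rewrite size_stack size_takel // subnn [omit _ (stack _ _)]omit_map.
by rewrite /omit take0 drop_drop add1n.
Qed.

End Lattice.

(** * Cross products of chains *)

Section Cross.
Variables (R : realType) (X Y : digraph).
Notation chX := (chain R X).
Notation chY := (chain R Y).
Implicit Types (s : seq X) (v w : Y).
Notation chZ := (chain R (box X Y)).

(** The cross product of a path with the arrow v w, a triangulation of the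
    strip over s.  Signs count from the start of s, so that bd_crossE carries
    no sign depending on the degree. *)
Definition sweep q (s : seq X) (v w : Y) : chZ q.+1 :=
  \sum_(j < q) (-1) ^+ j *: epath R q.+1 (elevate j s v w).

(** Cross products are set up for chains of degree 0 and 1 of Y only: a thin
    factor has no others in Omega. *)
Definition crossV q (u : chX q) (f : chY 1) : chZ q :=
  \sum_(t : rpath X q) u t *:
    \sum_(v : Y) pcoef f [:: v] *: epath R q (stack (path_seq t) v).

Definition crossE q (u : chX q) (g : chY 2) : chZ q.+1 :=
  \sum_(t : rpath X q) u t *:
    \sum_(a : Y * Y) pcoef g [:: a.1; a.2] *: sweep q (path_seq t) a.1 a.2.

Lemma crossVl q f : linear (fun u : chX q => crossV u f).
Proof.
move=> a u u1; rewrite /crossV scaler_sumr -big_split; apply: eq_bigr => t _.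
by rewrite !ffunE /= scalerDl scalerA.
Qed.

Lemma crossVr q (u : chX q) : linear (crossV u).
Proof.
move=> a f g; rewrite /crossV scaler_sumr -big_split; apply: eq_bigr => t _ /=.
rewrite scalerA mulrC -scalerA -scalerDr; congr (_ *: _).
rewrite scaler_sumr -big_split; apply: eq_bigr => v _ /=.
by rewrite pcoef_linear scalerDl scalerA.
Qed.

Lemma crossEl q g : linear (fun u : chX q => crossE u g).
Proof.
move=> a u u1; rewrite /crossE scaler_sumr -big_split; apply: eq_bigr => t _.
by rewrite !ffunE /= scalerDl scalerA.
Qed.

Lemma crossEr q (u : chX q) : linear (crossE u).
Proof.
move=> a f g; rewrite /crossE scaler_sumr -big_split; apply: eq_bigr => t _ /=.
rewrite scalerA mulrC -scalerA -scalerDr; congr (_ *: _).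
rewrite scaler_sumr -big_split; apply: eq_bigr => v _ /=.
by rewrite pcoef_linear scalerDl scalerA.
Qed.

Lemma chain1_ind (P : chY 1 -> Prop) :
  P 0 -> (forall a f g, P f -> P g -> P (a *: f + g)) ->
  (forall v, P (epath R 1 [:: v])) -> forall f, P f.
Proof.
move=> P0 PD Pe; apply: chain_ind => // -[|v [|w s]] // _ _ _; exact: Pe.
Qed.

Lemma chain2_ind (P : chY 2 -> Prop) :
  P 0 -> (forall a f g, P f -> P g -> P (a *: f + g)) ->
  (forall v w, v != w -> P (epath R 2 [:: v; w])) -> forall f, P f.
Proof.
move=> P0 PD Pe; apply: chain_ind => // -[|v [|w [|z s]]] // _ _.
by rewrite /regular /= andbT; exact: Pe.
Qed.

Lemma epath_comb (V : lmodType R) q (G : digraph) (s : seq G) (F : seq G -> V) :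
  \sum_(t : rpath G q) epath R q s t *: F (path_seq t) =
  [&& size s == q, (0 < q)%N & regular s]%:R *: F s.
Proof.
case: (pathP q s) => [t0 ->|h].
  rewrite (bigD1 t0) //= ffunE eqxx big1 ?addr0 // => t nt.
  rewrite ffunE; case: eqP => [e|_]; last by rewrite scale0r.
  by case/eqP: nt; apply: val_inj; apply: val_inj.
rewrite scale0r big1 // => t _.
by rewrite ffunE (negbTE (h t)) scale0r.
Qed.

Lemma valid_stack q s (v : Y) :
  [&& size (stack s v) == q, (0 < q)%N & regular (stack s v)] =
  [&& size s == q, (0 < q)%N & regular s].
Proof. by rewrite size_stack regular_stack. Qed.

Lemma crossV_epath q s v :
  crossV (epath R q s) (epath R 1 [:: v]) = epath R q (stack s v).
Proof.
rewrite /crossV (epath_comb _ s (fun s' : seq X => \sum_(v' : Y)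
   pcoef (epath R 1 [:: v]) [:: v'] *: epath R q (stack s' v'))).
rewrite (bigD1 v) //= big1 ?addr0 => [|w wv]; last first.
  by rewrite pcoef_epath eqseq_cons andbT [v == w]eq_sym (negbTE wv) andbF scale0r.
rewrite pcoef_epath eqxx /= scale1r.
case: (boolP [&& _, _ & _]) => h; first by rewrite scale1r.
by rewrite scale0r epath_eq0 // valid_stack.
Qed.

Lemma sweep0 q s v w : v != w ->
  ~~ [&& size s == q, (0 < q)%N & regular s] -> size s = q -> sweep q s v w = 0.
Proof.
move=> vw h ss; rewrite /sweep big1 // => j _; rewrite epath_eq0 ?scaler0 //.
have jq : (j < size s)%N by rewrite ss.
rewrite size_elevate // regular_elevate // ss eqxx /=.
by move: h; rewrite ss eqxx /=; case: (q) j {jq} => // -[].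
Qed.

Lemma crossE_epath q s v w : size s = q -> v != w ->
  crossE (epath R q s) (epath R 2 [:: v; w]) = sweep q s v w.
Proof.
move=> ss vw; rewrite /crossE (epath_comb _ s (fun s' : seq X =>
   \sum_(a : Y * Y) pcoef (epath R 2 [:: v; w]) [:: a.1; a.2] *: sweep q s' a.1 a.2)).
rewrite (bigD1 (v, w)) //= big1 ?addr0 => [|[v' w'] vw']; last first.
  have e : (v == v') && (w == w') = false.
    by apply/negbTE; move: vw'; rewrite eq_sym.
  by rewrite pcoef_epath !eqseq_cons andbT /= e andbF scale0r.
rewrite pcoef_epath eqxx /regular /= vw /= scale1r.
case: (boolP [&& _, _ & _]) => h; first by rewrite scale1r.
by rewrite scale0r sweep0.
Qed.

Lemma pcoef_crossV_stack q (u : chX q) f s v :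
  pcoef (crossV u f) (stack s v) = pcoef u s * pcoef f [:: v].
Proof.
elim/chain_ind: u => [|a u1 u2 h1 h2|s' ss q0 rs].
- by rewrite (linear_0 (crossVl f)) !pcoef0 mul0r.
- by rewrite crossVl !pcoef_linear h1 h2 mulrDl mulrA.
elim/chain1_ind: f => [|a f1 f2 h1 h2|w].
- by rewrite (linear_0 (crossVr _)) !pcoef0 mulr0.
- by rewrite crossVr !pcoef_linear h1 h2 mulrDr mulrCA.
rewrite crossV_epath !pcoef_epath valid_stack ss eqxx q0 rs /= -natrM mulnb.
by rewrite stack_inj ?ss // eqseq_cons andbT.
Qed.

Lemma pcoef_crossV_elevate q (u : chX q) f j s v w : (j < size s)%N -> v != w ->
  pcoef (crossV u f) (elevate j s v w) = 0.
Proof.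
move=> js vw; elim/chain_ind: u => [|a u1 u2 h1 h2|s' ss q0 rs].
- by rewrite (linear_0 (crossVl f)) !pcoef0.
- by rewrite crossVl !pcoef_linear h1 h2 mulr0 addr0.
elim/chain1_ind: f => [|a f1 f2 h1 h2|v'].
- by rewrite (linear_0 (crossVr _)) !pcoef0.
- by rewrite crossVr !pcoef_linear h1 h2 mulr0 addr0.
by rewrite crossV_epath pcoef_epath (negbTE (stack_elevate _ _ js vw)) andbF.
Qed.

Lemma pcoef_crossE_stack q (u : chX q) g s v : pcoef (crossE u g) (stack s v) = 0.
Proof.
elim/chain_ind: u => [|a u1 u2 h1 h2|s' ss q0 rs].
- by rewrite (linear_0 (crossEl g)) !pcoef0.
- by rewrite crossEl !pcoef_linear h1 h2 mulr0 addr0.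
elim/chain2_ind: g => [|a f1 f2 h1 h2|v' w' vw].
- by rewrite (linear_0 (crossEr _)) !pcoef0.
- by rewrite crossEr !pcoef_linear h1 h2 mulr0 addr0.
rewrite crossE_epath // pcoef_comb big1 // => j _.
rewrite pcoef_epath; have js : (j < size s')%N by rewrite ss.
by rewrite [_ == stack _ _]eq_sym (negbTE (stack_elevate _ _ js vw)) andbF mulr0.
Qed.

Lemma pcoef_crossE_elevate q (u : chX q) g j s v w : (j < size s)%N -> v != w ->
  pcoef (crossE u g) (elevate j s v w) = (-1) ^+ j * (pcoef u s * pcoef g [:: v; w]).
Proof.
move=> js vw; elim/chain_ind: u => [|a u1 u2 h1 h2|s' ss q0 rs].
- by rewrite (linear_0 (crossEl g)) !pcoef0 mul0r mulr0.
- by rewrite crossEl !pcoef_linear h1 h2; ring.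
elim/chain2_ind: g => [|a f1 f2 h1 h2|v' w' vw'].
- by rewrite (linear_0 (crossEr _)) !pcoef0 !mulr0.
- by rewrite crossEr !pcoef_linear h1 h2; ring.
rewrite crossE_epath // pcoef_comb pcoef_epath ss eqxx q0 rs pcoef_epath !eqseq_cons.
rewrite {1}/regular /= vw' !andbT /=.
case: (eqVneq (size s) q) => sq; last first.
  rewrite big1 => [|i _]; last first.
    rewrite pcoef_notpath ?mulr0 // size_elevate // eqSS (negbTE sq) //.
  case: eqP => [e|_]; last by rewrite mul0r mulr0.
  by rewrite -e ss eqxx in sq.
have jq : (j < q)%N by rewrite -sq.
rewrite (bigD1 (Ordinal jq)) //= big1 ?addr0 => [|i ij]; last first.
  rewrite pcoef_epath elevate_inj ?ss ?sq //.
  by rewrite -[i == j :> nat]/(i == Ordinal jq) (negbTE ij) andbF mulr0.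
rewrite pcoef_epath elevate_inj ?ss ?sq // eqxx size_elevate ?ss // eqxx.
rewrite regular_elevate ?ss // rs /=; congr (_ * _).
by rewrite -natrM mulnb.
Qed.

Lemma dotc_crossV q (u u' : chX q) f f' :
  dotc (crossV u f) (crossV u' f') = dotc u u' * dotc f f'.
Proof.
elim/chain_ind: u' => [|a u1 u2 h1 h2|s ss q0 rs].
- by rewrite (linear_0 (crossVl _)) dotcC [dotc u 0]dotcC !dotc0l ?mul0r.
- by rewrite crossVl !dotc_linearr h1 h2 mulrDl mulrA.
elim/chain1_ind: f' => [|a f1 f2 h1 h2|v].
- by rewrite (linear_0 (crossVr _)) dotcC [dotc f 0]dotcC !dotc0l ?mulr0.
- by rewrite crossVr !dotc_linearr h1 h2 mulrDr mulrCA.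
by rewrite crossV_epath; exact: pcoef_crossV_stack.
Qed.

Lemma dotc_crossVE q (u : chX q.+1) (u' : chX q) f g :
  dotc (crossV u f) (crossE u' g) = 0.
Proof.
elim/chain_ind: u' => [|a u1 u2 h1 h2|s ss q0 rs].
- by rewrite (linear_0 (crossEl _)) dotcC !dotc0l.
- by rewrite crossEl !dotc_linearr h1 h2 mulr0 addr0.
elim/chain2_ind: g => [|a f1 f2 h1 h2|v w vw].
- by rewrite (linear_0 (crossEr _)) dotcC !dotc0l.
- by rewrite crossEr !dotc_linearr h1 h2 mulr0 addr0.
rewrite crossE_epath // dotc_sumr big1 // => j _.
by rewrite -/(pcoef _ _) pcoef_crossV_elevate ?ss // mulr0.
Qed.

(** The q lattice paths of a sweep are distinct, and distinct from those of
    other sweeps; this factor q takes the weight 1/(q-1)! to 1/q!. *)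
Lemma dotc_crossE q (u u' : chX q) g g' :
  dotc (crossE u g) (crossE u' g') = q%:R * (dotc u u' * dotc g g').
Proof.
elim/chain_ind: u' => [|a u1 u2 h1 h2|s ss q0 rs].
- by rewrite (linear_0 (crossEl _)) dotcC [dotc u 0]dotcC !dotc0l ?mul0r ?mulr0.
- by rewrite crossEl !dotc_linearr h1 h2; ring.
elim/chain2_ind: g' => [|a f1 f2 h1 h2|v w vw].
- by rewrite (linear_0 (crossEr _)) dotcC [dotc g 0]dotcC !dotc0l ?mulr0.
- by rewrite crossEr !dotc_linearr h1 h2; ring.
rewrite crossE_epath // dotc_sumr.
rewrite (eq_bigr (fun=> pcoef u s * pcoef g [:: v; w])) => [|j _]; last first.
  by rewrite -/(pcoef _ _) pcoef_crossE_elevate ?ss // mulrA -expr2 sqrr_sign mul1r.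
by rewrite sumr_const card_ord mulr_natl.
Qed.

Lemma bd_lin (G : digraph) q : linear (bd R G q).
Proof. exact: linearP. Qed.

Lemma bd_crossV q (u : chX q.+1) f :
  bd R (box X Y) q (crossV u f) = crossV (bd R X q u) f.
Proof.
elim/chain_ind: u => [|a u1 u2 h1 h2|s ss q0 rs].
- by rewrite (linear_0 (crossVl _)) !linear0 (linear_0 (crossVl _)).
- by rewrite crossVl !linearP /= crossVl h1 h2.
elim/chain1_ind: f => [|a f1 f2 h1 h2|v].
- by rewrite !(linear_0 (crossVr _)) linear0.
- by rewrite !crossVr bd_lin h1 h2.
rewrite crossV_epath !bd_epath ?size_stack // (linear_comb (crossVl _)).
by apply: eq_bigr => k _; rewrite crossV_epath omit_map.
Qed.

Lemma bd_edge v w : bd R Y 1 (epath R 2 [:: v; w]) = epath R 1 [:: w] - epath R 1 [:: v].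
Proof.
by rewrite bd_epath // !big_ord_recl big_ord0 /= expr0 scale1r expr1 scaleN1r addr0.
Qed.

(** Omitting a vertex of the horizontal parts gives sweeps of shorter paths.
    Omitting an end of the vertical step gives jumps; each inner jump occurs
    in two neighbouring terms with opposite signs, and the sum telescopes to
    the copies of s at heights w and v. *)
Lemma bd_sweep q s v w : size s = q.+1 -> v != w ->
  bd R (box X Y) q.+1 (sweep q.+1 s v w) =
  epath R q.+1 (stack s w) - epath R q.+1 (stack s v)
  - \sum_(k < q.+1) (-1) ^+ k *: sweep q (omit k s) v w.
Proof.
move=> ss vw; pose E (t : seq (box X Y)) := epath R q.+1 t.
pose H i k : chZ q.+1 := (-1) ^+ (i + k) *: E (elevate i (omit k s) v w).
pose D j := E (jump j s v w).
(* The boundary of one lattice path: two jumps, then the omissions before and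
   after the vertical step. *)
have step j : (j < q.+1)%N ->
    (-1) ^+ j *: bd R (box X Y) q.+1 (epath R q.+2 (elevate j s v w)) =
    (D j - D j.+1) - \sum_(0 <= k < j) H j.-1 k - \sum_(j.+1 <= k < q.+1) H j k.
  move=> jq; have js : (j < size s)%N by rewrite ss.
  rewrite bd_epath ?size_elevate ?ss // -(big_mkord xpredT (fun k =>
     (-1) ^+ k *: epath R q.+1 (omit k (elevate j s v w)))).
  rewrite (@big_cat_nat _ _ _ j) //=; last by lia.
  rewrite [X in _ *: (_ + X)]big_ltn; last by lia.
  rewrite [X in _ *: (_ + (_ + X))]big_ltn; last by lia.
  rewrite omit_elevate_l // omit_elevate_r // !scalerDr !scalerA.
  have sg : (-1) ^+ j * (-1) ^+ j = 1 :> R by rewrite -expr2 sqrr_sign.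
  rewrite exprS mulrCA sg mulr1 scale1r scaleN1r.
  rewrite addrCA -!addrA; congr (_ + _).
  rewrite addrCA !scaler_sumr -!sumrN; congr (_ + (_ + _)).
    apply: eq_big_nat => k /andP[_ kj]; rewrite omit_elevate_lt //.
    rewrite scalerA -exprD /H -scaleNr; congr (_ *: _).
    have -> : (j + k = (j.-1 + k).+1)%N by lia.
    by rewrite exprS mulN1r.
  rewrite big_add1 /=; apply: eq_big_nat => k /andP[jk kq].
  rewrite omit_elevate_gt ?ss //= scalerA -exprD /H -scaleNr; congr (_ *: _).
  by rewrite addnS exprS mulN1r.
rewrite /sweep linear_sum /=.
under eq_bigr => j _ do rewrite linearZ /= step //.
rewrite -(big_mkord xpredT (fun j => D j - D j.+1 - \sum_(0 <= k < j) H j.-1 k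
   - \sum_(j.+1 <= k < q.+1) H j k)) /=.
rewrite !sumrB.
have -> : \sum_(0 <= j < q.+1) D j - \sum_(0 <= j < q.+1) D j.+1 = D 0%N - D q.+1.
  by rewrite -sumrB -[LHS]opprK -sumrN; under eq_bigr do rewrite opprB;
    rewrite telescope_sumr // opprB.
rewrite /D /jump /E drop0 take0 /= drop_oversize ?ss // take_oversize ?ss // cats0.
rewrite -addrA -opprD; congr (_ - _ - _).
rewrite big_ltn // [X in X + _ + _]big_geq // add0r big_add1 /=.
rewrite [X in _ + X]big_nat_recr //= [X in _ + (_ + X)]big_geq // addr0 -big_split /=.
under [RHS]eq_bigr => k _ do rewrite scaler_sumr.
rewrite exchange_big /= -(big_mkord xpredT (fun i => \sum_(k < q.+1)
   (-1) ^+ k *: ((-1) ^+ i *: E (elevate i (omit k s) v w)))).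
apply: eq_big_nat => i /andP[_ iq]; rewrite -big_cat_nat //=; last by lia.
rewrite big_mkord; apply: eq_bigr => k _.
by rewrite scalerA -exprD addnC.
Qed.

Lemma bd_crossE q (u : chX q.+1) g :
  bd R (box X Y) q.+1 (crossE u g) =
  crossV u (bd R Y 1 g) - crossE (bd R X q u) g.
Proof.
elim/chain_ind: u => [|a u1 u2 h1 h2|s ss q0 rs].
- rewrite (linear_0 (crossEl _)) !linear0 (linear_0 (crossVl _)) (linear_0 (crossEl _)).
  exact: (esym (subrr _)).
- rewrite crossEl !bd_lin /= crossVl crossEl h1 h2 scalerBr opprD.
  by rewrite addrACA.
elim/chain2_ind: g => [|a f1 f2 h1 h2|v w vw].
- rewrite !(linear_0 (crossEr _)) !linear0 (linear_0 (crossVr _)).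
  exact: (esym (addr0 _)).
- rewrite !crossEr !bd_lin crossVr h1 h2 scalerBr opprD.
  by rewrite addrACA.
rewrite crossE_epath // bd_sweep // bd_edge (linear_B (crossVr _)) !crossV_epath.
congr (_ - _); rewrite bd_epath // (linear_comb (crossEl _)).
by apply: eq_bigr => k _; rewrite crossE_epath // size_omit ss.
Qed.

End Cross.

(** * The Kunneth decomposition for a thin factor *)

(** The local content of having no double arrow, triangle or square: the gap
    left by two consecutive arrows is a regular pair, not an arrow, and has a
    single filling. *)
Definition thin (Y : digraph) := forall b c d : Y, arrow b c -> arrow c d ->
  [/\ b != d, ~~ arrow b d & forall m, arrow b m -> arrow m d -> m = c].

Lemma thinP (G : digraph) : ~ has_double_arrow G -> ~ has_triangle G ->
  ~ has_square G -> thin G.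
Proof.
move=> nd nt ns b c d bc cd.
have neq (x y : G) : arrow x y -> x != y.
  by apply: contraTneq => ->; rewrite arrow_irr.
have bd : b != d.
  apply/eqP => e; apply: nd; exists b, c; split; rewrite ?neq //.
  by rewrite e.
have nbd : ~~ arrow b d.
  apply/negP => abd; apply: nt; exists b, c, d; split => //=.
  by rewrite !inE negb_or (neq _ _ bc) (neq _ _ cd) bd.
split=> // m bm md; apply/eqP/negPn/negP => mc; apply: ns; exists b, c, m, d.
split; rewrite ?bc ?bm //= !inE !negb_or (neq _ _ bc) (neq _ _ bm) bd.
by rewrite (neq _ _ cd) (neq _ _ md) eq_sym mc.
Qed.

Section Kunneth.
Variables (R : realType) (X Y : digraph).
Notation Z := (box X Y).

Lemma epath_A (G : digraph) q (s : seq G) : allowed s -> epath R q s \in Aspace R G q.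
Proof.
move=> sA; apply/AspaceP => s' s'A; rewrite pcoef_epath.
by case: (s =P s') => [e|_]; rewrite ?andbF //; rewrite e (negbTE s'A) in sA.
Qed.

Lemma Aspace1 (G : digraph) (f : chain R G 1) : f \in Aspace R G 1.
Proof.
apply/AspaceP => s sA; apply: pcoef_notpath; apply: contra sA.
by case: s => [|x [|y s]].
Qed.

Lemma Omega1 (G : digraph) (f : chain R G 1) : f \in Omega R G 1.
Proof. by rewrite OmegaS Aspace1 (chain_deg0 (bd _ _ _ _)) mem0v. Qed.

Lemma Omega2E (G : digraph) (g : chain R G 2) :
  (g \in Omega R G 2) = (g \in Aspace R G 2).
Proof. by rewrite OmegaS Aspace1 andbT. Qed.

Lemma crossV_A q (u : chain R X q) (f : chain R Y 1) :
  u \in Aspace R X q -> crossV u f \in Aspace R Z q.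
Proof.
move=> uA; apply: memv_suml => t _.
case: (boolP (allowed (path_seq t))) => tA; last first.
  by rewrite -pcoefE (AspaceP _ uA) // scale0r mem0v.
apply/memvZ/memv_suml => v _; apply/memvZ/epath_A.
by rewrite allowed_stack.
Qed.

Lemma crossE_A q (u : chain R X q) (g : chain R Y 2) :
  u \in Aspace R X q -> g \in Aspace R Y 2 -> crossE u g \in Aspace R Z q.+1.
Proof.
move=> uA gA; apply: memv_suml => t _.
case: (boolP (allowed (path_seq t))) => tA; last first.
  by rewrite -pcoefE (AspaceP _ uA) // scale0r mem0v.
apply/memvZ/memv_suml => -[v w] _ /=.
case: (boolP (arrow v w)) => vw; last first.
  by rewrite (AspaceP _ gA) ?scale0r ?mem0v // /allowed /= andbT.
apply/memvZ/memv_suml => j _; apply/memvZ/epath_A.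
by rewrite allowed_elevate ?tA // size_tuple.
Qed.

Lemma crossV_Omega q (u : chain R X q) (f : chain R Y 1) :
  u \in Omega R X q -> crossV u f \in Omega R Z q.
Proof.
case: q u => [u _|q u]; first by rewrite (chain_deg0 (crossV _ _)) mem0v.
by rewrite !OmegaS bd_crossV => /andP[uA bA]; rewrite !crossV_A.
Qed.

Lemma crossE_Omega q (u : chain R X q) (g : chain R Y 2) :
  u \in Omega R X q -> g \in Omega R Y 2 -> crossE u g \in Omega R Z q.+1.
Proof.
case: q u => [u _ _|q u].
  by rewrite (chain_deg0 u) (linear_0 (crossEl _)) mem0v.
rewrite !OmegaS bd_crossE => /andP[uA bA] /andP[gA _].
by rewrite crossE_A //= memvB ?crossV_A ?crossE_A.
Qed.

Lemma pcoef_box_gap q (w : chain R Z q.+1) y1 a m b y2 :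
  w \in Omega R Z q.+1 -> ~~ (@arrow Z a m && @arrow Z m b) ->
  pcoef w (y1 ++ a :: m :: b :: y2) = 0.
Proof.
move=> /OmegaP[wA _]; rewrite negb_and => h; apply: wA; apply/negP => al.
case/orP: h => /negP; apply; first exact: allowed_cat2 al.
by move: al; rewrite -cat_rcons => /allowed_cat2.
Qed.

(** The diagonal gap at a corner is filled by the two corners only, so their
    coefficients add up to zero. *)
Lemma pcoef_flip q (w : chain R Z q.+1) y1 (a a' : X) (b b' : Y) y2 :
  w \in Omega R Z q.+1 -> a != a' -> b != b' ->
  pcoef w (y1 ++ (a, b) :: (a', b) :: (a', b') :: y2) =
  - pcoef w (y1 ++ (a, b) :: (a, b') :: (a', b') :: y2).
Proof.
move=> wO aa bb; have [_ h] := OmegaP _ wO.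
have := h y1 (a, b) (a', b') y2.
rewrite /= /box_arrow /= xpair_eqE (negbTE aa) (negbTE bb) andbF => /(_ isT isT).
rewrite (bigD1 (a', b)) //= (bigD1 (a, b')) /=; last first.
  by rewrite xpair_eqE (negbTE aa).
rewrite big1 ?addr0 => [/eqP|[c d] /andP[n1 n2]].
  by rewrite addr_eq0 => /eqP.
apply: pcoef_box_gap => //; apply: contra n1 => /andP[]; rewrite /= /box_arrow /=.
case/orP=> /andP[h1 h2] /orP[] /andP[h3 h4].
- by rewrite (eqP h1) (eqP h3) eqxx in aa.
- by rewrite (eqP h1) (eqP h4) eqxx in n2.
- by rewrite (eqP h2) (eqP h3).
- by rewrite (eqP h2) (eqP h4) eqxx in bb.
Qed.

Hypothesis Ythin : thin Y.

(** Two consecutive steps in the thin factor leave a gap with one filling,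
    so the local condition consists of this coefficient alone. *)
Lemma pcoef_straight q (w : chain R Z q.+1) y1 (a : X) (b c d : Y) y2 :
  w \in Omega R Z q.+1 ->
  pcoef w (y1 ++ (a, b) :: (a, c) :: (a, d) :: y2) = 0.
Proof.
move=> wO; case: (boolP (arrow b c && arrow c d)) => [/andP[bc cd]|n]; last first.
  by apply: pcoef_box_gap => //; rewrite /= /box_arrow /= !eqxx !arrow_irr !orbF.
have [bd nbd bcd] := Ythin bc cd.
have [_ h] := OmegaP _ wO.
have := h y1 (a, b) (a, d) y2.
rewrite /= /box_arrow /= xpair_eqE !eqxx arrow_irr (negbTE bd) (negbTE nbd).
move=> /(_ isT isT); rewrite (bigD1 (a, c)) //= big1 ?addr0 //.
move=> [a' c'] /= n1; apply: pcoef_box_gap => //; apply: contra n1 => /andP[].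
rewrite /= /box_arrow /=; case/orP=> /andP[h1 h2] /orP[] /andP[h3 h4].
- by rewrite (bcd _ h2 h4) (eqP h1).
- by rewrite (eqP h1) arrow_irr in h3.
- by rewrite (eqP h3) arrow_irr in h1.
- by rewrite (eqP h2) (eqP h4) eqxx in bd.
Qed.

(** Flipping corners moves the first step in Y back to the position of
    (x, v), at the cost of a sign; this reduces all continuations to those
    without step in Y and those that begin with one. *)
Lemma pcoef_bubble q (w : chain R Z q.+1) y1 (x : X) (v : Y) :
  w \in Omega R Z q.+1 ->
  (forall s, pcoef w (y1 ++ stack (x :: s) v) = 0) ->
  (forall v' y2, v != v' -> pcoef w (y1 ++ (x, v) :: (x, v') :: y2) = 0) ->
  forall y2, pcoef w (y1 ++ (x, v) :: y2) = 0.
Proof.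
move=> wO h1 h2.
(* The induction moves the step back over the last vertex of the copy of X. *)
have bub s v' y2 : v != v' ->
    pcoef w (y1 ++ stack (x :: s) v ++ (last x s, v') :: y2) = 0.
  elim/last_ind: s v' y2 => [|s z ih] v' y2 vv'; first exact: h2.
  have -> : y1 ++ stack (x :: rcons s z) v ++ (last x (rcons s z), v') :: y2 =
      (y1 ++ stack (belast x s) v) ++ (last x s, v) :: (z, v) :: (z, v') :: y2.
    by rewrite last_rcons -rcons_cons stack_rcons lastI stack_rcons !cat_rcons !catA.
  case: (eqVneq (last x s) z) => [e|nz].
    apply: pcoef_notpath; rewrite e; apply/negP => /and3P[_ _ /regular_cat2].
    by rewrite eqxx.
  rewrite pcoef_flip // -catA -cat_rcons -stack_rcons -lastI.
  by rewrite ih // oppr0.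
move=> y2; have [s [y3 [-> hy]]] : exists s y3, y2 = stack s v ++ y3 /\
    (if y3 is z :: _ then z.2 != v else true).
  elim: y2 => [|[z w'] y2 [s [y3 [-> hy]]]]; first by exists [::], [::].
  case: (eqVneq w' v) => [->|wv]; first by exists (z :: s), y3.
  by exists [::], ((z, w') :: stack s v ++ y3).
have e : (x, v) :: stack s v ++ y3 = stack (x :: s) v ++ y3 by [].
case: y3 hy e => [|[z v'] y3] hy e.
  by rewrite e cats0.
case: (eqVneq z (last x s)) => [->|nz] in e *; first by rewrite e bub // eq_sym.
have [wA _] := OmegaP _ wO; apply: wA; rewrite e lastI stack_rcons cat_rcons catA.
apply/negP => /allowed_cat2; rewrite /= /box_arrow /= eq_sym (negbTE nz) /=.
by rewrite eq_sym (negbTE hy) andbF.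
Qed.

(** The first use of pcoef_bubble brings a step in Y to the front, the second
    one brings the next step in Y right behind it, where pcoef_straight
    applies. *)
Lemma Omega_box_eq0 q (w : chain R Z q.+1) : w \in Omega R Z q.+1 ->
  (forall s v, pcoef w (stack s v) = 0) ->
  (forall s v v', v != v' -> pcoef w (elevate 0 s v v') = 0) -> w = 0.
Proof.
move=> wO h1 h2; apply: chain_ext => -[|[x v] y2]; rewrite pcoef0.
  exact: pcoef_notpath.
apply: (@pcoef_bubble _ _ [::]) => // [s|v' y3 vv']; first exact: h1.
apply: (@pcoef_bubble _ _ [:: (x, v)]) => // [s|v'' y4 _].
  by have := h2 (x :: s) v v' vv'; rewrite /elevate /= take0.
exact: (@pcoef_straight _ _ [::]).
Qed.

Definition sliceV q (w : chain R Z q) (v : Y) : chain R X q :=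
  [ffun t => pcoef w (stack (path_seq t) v)].

Definition sliceE q (w : chain R Z q.+1) (v v' : Y) : chain R X q :=
  [ffun t => pcoef w (elevate 0 (path_seq t) v v')].

Lemma pcoef_sliceV q (w : chain R Z q) v s : pcoef (sliceV w v) s = pcoef w (stack s v).
Proof.
case: (boolP [&& size s == q, (0 < q)%N & regular s]) => h.
  by move: h; case: (pathP q s) => // t -> _; rewrite pcoefE ffunE.
by rewrite !pcoef_notpath // valid_stack.
Qed.

Lemma pcoef_sliceE q (w : chain R Z q.+1) v v' s : v != v' -> (0 < size s)%N ->
  pcoef (sliceE w v v') s = pcoef w (elevate 0 s v v').
Proof.
move=> vv' s0; case: (boolP [&& size s == q, (0 < q)%N & regular s]) => h.
  by move: h; case: (pathP q s) => // t -> _; rewrite pcoefE ffunE.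
rewrite !pcoef_notpath // size_elevate // regular_elevate // eqSS.
apply: contra h => /and3P[/eqP ss _ ->].
by rewrite ss eqxx -ss s0.
Qed.

(** A gap inside a copy of X at height v can only be filled at height v, so
    the local conditions for w include those for the slice. *)
Lemma sliceV_Omega q (w : chain R Z q.+1) v : w \in Omega R Z q.+1 ->
  sliceV w v \in Omega R X q.+1.
Proof.
move=> wO; have [wA h] := OmegaP _ wO; apply/OmegaP; split=> [s sA|y1 a b y2 nab ab].
  by rewrite pcoef_sliceV wA // allowed_stack.
have := h (stack y1 v) (a, v) (b, v) (stack y2 v).
rewrite /= /box_arrow /= xpair_eqE !eqxx arrow_irr (negbTE ab) (negbTE nab).
move=> /(_ isT isT); rewrite sum_pair => e; rewrite -[RHS]e {e}.
apply: eq_bigr => m _; rewrite (bigD1 v) //= big1 ?addr0 => [|v' vv'].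
  by rewrite pcoef_sliceV /stack map_cat.
apply: pcoef_box_gap => //.
rewrite /= /box_arrow /= [_ == v']eq_sym (negbTE vv') !andbF !orbF.
apply/negP => /andP[/andP[/eqP <- _] /andP[e _]].
by rewrite e in ab.
Qed.

Lemma sliceE_Omega q (w : chain R Z q.+1) v v' : v != v' ->
  w \in Omega R Z q.+1 -> sliceE w v v' \in Omega R X q.
Proof.
case: q w => [w _ _|q w vw wO]; first by rewrite (chain_deg0 (sliceE _ _ _)) mem0v.
have [wA h] := OmegaP _ wO; apply/OmegaP; split=> [s sA|y1 a b y2 nab ab].
  case: s sA => // x s sA.
  by rewrite pcoef_sliceE // wA // allowed_elevate // (negbTE sA).
have [y3 ey] : exists y3, forall y, elevate 0 (y1 ++ a :: y) v v' =
     y3 ++ (a, v') :: stack y v'.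
  case: (y1) => [|x y]; first by exists [:: (a, v)] => y; rewrite /elevate /= take0.
  exists ((x, v) :: stack (x :: y) v') => y'.
  by rewrite /elevate /= take0 /stack /= map_cat.
have := h y3 (a, v') (b, v') (stack y2 v').
rewrite /= /box_arrow /= xpair_eqE !eqxx arrow_irr (negbTE ab) (negbTE nab).
move=> /(_ isT isT); rewrite sum_pair => e; rewrite -[RHS]e {e}.
apply: eq_bigr => m _; rewrite (bigD1 v') //= big1 ?addr0 => [|v'' vv'].
  by rewrite pcoef_sliceE ?ey // size_cat addnS.
apply: pcoef_box_gap => //.
rewrite /= /box_arrow /= [_ == v'']eq_sym (negbTE vv') !andbF !orbF.
apply/negP => /andP[/andP[/eqP <- _] /andP[e _]].
by rewrite e in ab.
Qed.

(** The Kunneth formula for a thin factor Y as an induction principle: w minus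
    the cross products of its slices with the vertices and arrows of Y has no
    coefficients left on the paths tested in Omega_box_eq0. *)
Lemma Omega_box_ind q (P : chain R Z q.+1 -> Prop) :
  P 0 -> (forall a u v, P u -> P v -> P (a *: u + v)) ->
  (forall u v, u \in Omega R X q.+1 -> P (crossV u (epath R 1 [:: v]))) ->
  (forall u v v', u \in Omega R X q -> arrow v v' -> P (crossE u (epath R 2 [:: v; v']))) ->
  forall w, w \in Omega R Z q.+1 -> P w.
Proof.
move=> P0 PD PV PE w wO.
have PDD u v : P u -> P v -> P (u + v).
  by move=> hu hv; rewrite -[u]scale1r; exact: PD.
pose wV := \sum_v crossV (sliceV w v) (epath R 1 [:: v]).
pose wE := \sum_(a : Y * Y | arrow a.1 a.2)
   crossE (sliceE w a.1 a.2) (epath R 2 [:: a.1; a.2]).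
have neq (v v' : Y) : arrow v v' -> v != v'.
  by apply: contraTneq => ->; rewrite arrow_irr.
suff -> : w = wV + wE.
  apply: (PDD).
    apply: big_ind; [exact: P0|exact: PDD|] => v _.
    exact/PV/sliceV_Omega.
  apply: big_ind; [exact: P0|exact: PDD|] => -[v v'] vv'.
  by apply: PE => //; apply: sliceE_Omega => //; exact: neq.
apply/eqP; rewrite -subr_eq0; apply/eqP; apply: Omega_box_eq0.
- rewrite memvB // memvD //; apply: memv_suml.
    by move=> v _; exact/crossV_Omega/sliceV_Omega.
  move=> [v v'] vv'.
  apply: crossE_Omega; first by apply: sliceE_Omega => //; exact: neq.
  by rewrite Omega2E epath_A // /allowed /= vv'.
- move=> s v; rewrite pcoefB pcoefD !pcoef_sum.
  rewrite [X in _ - (_ + X)]big1 ?addr0 => [|a _]; last exact: pcoef_crossE_stack.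
  rewrite (bigD1 v) //= big1 ?addr0 => [|v' v'v]; last first.
    by rewrite pcoef_crossV_stack pcoef_epath !eqseq_cons andbT (negbTE v'v) andbF mulr0.
  by rewrite pcoef_crossV_stack pcoef_epath eqxx mulr1 pcoef_sliceV subrr.
move=> [|x s] v v' vv'; first exact: pcoef_notpath.
rewrite pcoefB pcoefD !pcoef_sum.
rewrite [X in _ - (X + _)]big1 ?add0r => [|a _]; last exact: pcoef_crossV_elevate.
case: (boolP (arrow v v')) => avv'; last first.
  rewrite big1 ?subr0 => [|[a a'] /= aa'].
    by have [wA _] := OmegaP _ wO; rewrite wA // allowed_elevate // (negbTE avv') andbF.
  rewrite pcoef_crossE_elevate // pcoef_epath !eqseq_cons.
  case: (a =P v) => [ea|_]; last by rewrite andbF !mulr0.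
  case: (a' =P v') => [ea'|_]; last by rewrite !andbF !mulr0.
  by rewrite -ea -ea' aa' in avv'.
rewrite (bigD1 (v, v')) //= big1 ?addr0 => [|[a a'] /= /andP[_ n]]; last first.
  have e : (a == v) && (a' == v') = false by exact: (negbTE n).
  by rewrite pcoef_crossE_elevate // pcoef_epath !eqseq_cons andbT e andbF !mulr0.
rewrite pcoef_crossE_elevate // pcoef_epath eqxx /regular /= vv' expr0 mul1r mulr1.
by rewrite pcoef_sliceE // subrr.
Qed.

End Kunneth.

(** * Coboundaries and Laplacians of cross products *)

Section Eig.
Variables (R : realType) (G : digraph).

Definition ndot q (u v : chain R G q) : R := (q.-1)`!%:R^-1 * dotc u v.

Lemma ndot_inner q : inner_product (@ndot q).
Proof. by apply: dotc_inner; rewrite invr_gt0 ltr0n fact_gt0. Qed.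

Lemma ndotC q (u v : chain R G q) : ndot u v = ndot v u.
Proof. by rewrite /ndot dotcC. Qed.

Lemma ndot_linearl q a (u v w : chain R G q) : ndot (a *: u + v) w = a * ndot u w + ndot v w.
Proof. by rewrite /ndot dotc_linearl mulrDr mulrCA. Qed.

Lemma ndot_linearr q a (u v w : chain R G q) : ndot w (a *: u + v) = a * ndot w u + ndot w v.
Proof. by rewrite ndotC ndot_linearl !(ndotC w). Qed.

Lemma ndotDr q (u v w : chain R G q) : ndot w (u + v) = ndot w u + ndot w v.
Proof. by rewrite -[u in LHS]scale1r ndot_linearr mul1r. Qed.

Lemma ndotBl q (u v w : chain R G q) : ndot (u - v) w = ndot u w - ndot v w.
Proof. by rewrite addrC -scaleN1r ndot_linearl mulN1r addrC. Qed.

Lemma ndotBr q (u v w : chain R G q) : ndot w (u - v) = ndot w u - ndot w v.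
Proof. by rewrite addrC -scaleN1r ndot_linearr mulN1r addrC. Qed.

Lemma ndot0l q (u : chain R G q) : ndot 0 u = 0.
Proof. by rewrite /ndot dotc0l mulr0. Qed.

Lemma ndot0r q (u : chain R G q) : ndot u 0 = 0.
Proof. by rewrite ndotC ndot0l. Qed.

Lemma ndot_eq0 q (u : chain R G q) : ndot u u = 0 -> u = 0.
Proof. by case: (ndot_inner q) => _ _ _; exact. Qed.

(** The adjoint of the boundary as a relation between chains, determined by
    duality against Omega; working with it avoids the subtypes on which the
    adjoint operator is defined (see adj_cobd). *)
Definition cobd q (u : chain R G q) (c : chain R G q.+1) : Prop :=
  c \in Omega R G q.+1 /\
  forall t, t \in Omega R G q.+1 -> ndot (bd R G q t) u = ndot t c.

Lemma cobd_linear q a (u u' : chain R G q) c c' :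
  cobd u c -> cobd u' c' -> cobd (a *: u + u') (a *: c + c').
Proof.
case=> cO h [cO' h']; split=> [|t tO]; first by rewrite memvD ?memvZ.
by rewrite !ndot_linearr h ?h'.
Qed.

Lemma cobd0 q : cobd (0 : chain R G q) 0.
Proof. by split=> [|t _]; rewrite ?mem0v ?ndot0r. Qed.

(** Eigenvectors of the normalized Laplacian, for chains on q vertices.  The
    case q = 0 carries no condition, so that degree -1 of one factor can enter
    the induction on Cartesian powers. *)
Definition hodge_eigen q : chain R G q -> R -> Prop :=
  match q with
  | 0 => fun _ _ => True
  | p.+1 => fun u mu => u \in Omega R G p.+1 /\ exists c d,
      [/\ cobd u c, cobd (bd R G p u) d & bd R G p.+1 c + d = mu *: u]
  end.

(** In degree 0 the boundary of f vanishes, so only the upper part of the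
    Laplacian remains; in degree 1 of a thin digraph only the lower part
    does, whence eigen_edge. *)
Definition eigen_vertex (f : chain R G 1) lam : Prop :=
  exists2 df, cobd f df & bd R G 1 df = lam *: f.

Definition eigen_edge (g : chain R G 2) lam : Prop :=
  g \in Omega R G 2 /\ cobd (bd R G 1 g) (lam *: g).

Lemma hodge_eigen_Omega q (u : chain R G q) mu : hodge_eigen u mu -> u \in Omega R G q.
Proof. by case: q u => [u _|q u []] //; rewrite (chain_deg0 u) mem0v. Qed.

Lemma ndotE : (fun q (u v : chain R G q) => (q.-1)`!%:R^-1 * dotc u v) = ndot.
Proof. by []. Qed.

Lemma adj_cobd q (u : chain R G q) c : u \in Omega R G q -> cobd u c ->
  bdOmega_adj ndot q (vsproj (Omega R G q) u) = vsproj (Omega R G q.+1) c.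
Proof.
move=> uO [cO h].
have I1 := ipOmega_inner (ndot_inner q.+1).
have I0 := ipOmega_inner (ndot_inner q).
have := adjointP (bdOmega R G q) I1 I0; rewrite /is_adjoint -/(bdOmega_adj ndot q).
set x := bdOmega_adj _ _ _ => had.
apply: subvs_inj; rewrite vsprojK //; apply/eqP; rewrite -subr_eq0; apply/eqP/ndot_eq0.
set y := (_ - _); have yO : y \in Omega R G q.+1 by rewrite memvB // subvsP.
have := had (vsproj _ y) (vsproj _ u); rewrite /ipOmega bdOmegaE !vsprojK // -/x h // => e.
by rewrite {2}/y ndotBr -e subrr.
Qed.

Lemma normalized_hodge_eigen p (u : chain R G p.+1) mu : hodge_eigen u mu ->
  normalized_hodge R G p (vsproj (Omega R G p.+1) u) =
  mu *: vsproj (Omega R G p.+1) u.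
Proof.
case=> uO [c [d [hc hd e]]].
rewrite /normalized_hodge ndotE /hodge add_lfunE !comp_lfunE (adj_cobd uO hc).
have -> : bdOmega R G p (vsproj (Omega R G p.+1) u) =
          vsproj (Omega R G p) (bd R G p u).
  by apply: subvs_inj; rewrite bdOmegaE !vsprojK // bd_Omega.
rewrite (adj_cobd (bd_Omega uO) hd); apply: subvs_inj.
have [cO _] := hc; have [dO _] := hd.
by rewrite linearD linearZ /= bdOmegaE !vsprojK.
Qed.

End Eig.

Section EigBox.
Variables (R : realType) (X Y : digraph).
Hypothesis Ythin : thin Y.

Lemma ndot_crossV q (u u' : chain R X q) (f f' : chain R Y 1) :
  ndot (crossV u f) (crossV u' f') = ndot u u' * ndot f f'.
Proof. by rewrite /ndot dotc_crossV fact0 invr1 mul1r mulrA. Qed.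

Lemma ndot_crossE q (u u' : chain R X q) (g g' : chain R Y 2) :
  ndot (crossE u g) (crossE u' g') = ndot u u' * ndot g g'.
Proof.
rewrite /ndot dotc_crossE (_ : (2.-1)`! = 1)%N // invr1 mul1r; case: q u u' => [u u'|q u u'].
  by rewrite (chain_deg0 u) dotc0l !mul0r !mulr0 mul0r.
rewrite /= factS natrM invfM !mulrA; congr (_ * _ * _).
by rewrite mulrAC mulVf ?mul1r // pnatr_eq0.
Qed.

Lemma ndot_crossVE q (u : chain R X q.+1) (u' : chain R X q) f (g : chain R Y 2) :
  ndot (crossV u f) (crossE u' g) = 0.
Proof. by rewrite /ndot dotc_crossVE mulr0. Qed.

Lemma ndot_crossEV q (u : chain R X q.+1) (u' : chain R X q) f (g : chain R Y 2) :
  ndot (crossE u' g) (crossV u f) = 0.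
Proof. by rewrite ndotC ndot_crossVE. Qed.

(** It suffices to test on cross products; there ndot is multiplicative, and
    crossV and crossE are orthogonal, so the product rule for the boundary
    dualizes term by term. *)
Lemma cobd_crossV q (u : chain R X q) c (f : chain R Y 1) df :
  u \in Omega R X q -> cobd u c -> cobd f df ->
  cobd (crossV u f) (crossV c f + crossE u df).
Proof.
move=> uO [cO hc] [dO hd]; split=> [|t].
  by rewrite memvD ?crossV_Omega ?crossE_Omega.
move: t; apply: (Omega_box_ind Ythin) => [|a t t' h h'|t v tO|t v w tO vw].
- by rewrite linear0 !ndot0l.
- by rewrite bd_lin !ndot_linearl h h'.
- by rewrite bd_crossV ndotDr ndot_crossVE addr0 !ndot_crossV hc.
rewrite ndotDr ndot_crossEV add0r ndot_crossE.
have vwO : epath R 2 [:: v; w] \in Omega R Y 2.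
  by rewrite Omega2E epath_A // /allowed /= vw.
case: q u c uO cO hc t tO => [|q] u c uO cO hc t tO.
  by rewrite (chain_deg0 t) (linear_0 (crossEl _)) linear0 !ndot0l mul0r.
by rewrite bd_crossE ndotBl ndot_crossEV subr0 ndot_crossV hd.
Qed.

Lemma cobd_crossE q (u : chain R X q) c (g : chain R Y 2) :
  u \in Omega R X q -> cobd u c -> g \in Omega R Y 2 ->
  cobd (crossE u g) (- 1 *: crossE c g).
Proof.
move=> uO [cO hc] gO; split=> [|t].
  by rewrite memvZ ?crossE_Omega.
rewrite -[_ *: _]addr0 ndot_linearr ndot0r addr0; move: t.
apply: (Omega_box_ind Ythin) => [|a t t' h h'|t v tO|t v w tO vw].
- by rewrite linear0 !ndot0l mulr0.
- by rewrite bd_lin !ndot_linearl h h'; ring.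
- by rewrite bd_crossV !ndot_crossVE mulr0.
by rewrite bd_crossE ndotBl ndot_crossVE sub0r !ndot_crossE hc // mulN1r.
Qed.

(** The mixed terms, a boundary in X combined with a coboundary in Y, occur
    twice with opposite signs; what remains is the sum of the two Laplacians. *)
Lemma hodge_eigen_crossV q (u : chain R X q) mu (f : chain R Y 1) lam :
  hodge_eigen u mu -> eigen_vertex f lam -> hodge_eigen (crossV u f) (mu + lam).
Proof.
case: q u => [//|q] u [uO [c [d [hc hd e]]]] [df hf ef]; split.
  exact: crossV_Omega.
exists (crossV c f + crossE u df), (crossV d f + crossE (bd R X q u) df); split.
- exact: cobd_crossV.
- by rewrite bd_crossV; apply: cobd_crossV => //; exact: bd_Omega.
rewrite linearD /= bd_crossV bd_crossE ef (linear_Z (crossVr _)).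
rewrite addrACA subrK -(linear_D (crossVl f)) e (linear_Z (crossVl f)).
by rewrite -scalerDl.
Qed.

Lemma hodge_eigen_crossE q (u : chain R X q) mu (g : chain R Y 2) lam :
  hodge_eigen u mu -> eigen_edge g lam -> hodge_eigen (crossE u g) (mu + lam).
Proof.
case: q u => [u _ _|q u [uO [c [d [hc hd e]]]] [gO hg]].
  rewrite (chain_deg0 u) (linear_0 (crossEl g)); split; first exact: mem0v.
  exists 0, 0; split; first exact: cobd0.
    by rewrite linear0; exact: cobd0.
  by rewrite linear0 addr0 scaler0.
split; first exact: crossE_Omega.
exists (- 1 *: crossE c g),
  (- 1 *: (- 1 *: crossE d g) + (crossV c (bd R Y 1 g) + crossE u (lam *: g))).
split; first exact: cobd_crossE.
  rewrite bd_crossE addrC -scaleN1r; apply: cobd_linear; last exact: cobd_crossV.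
  by apply: cobd_crossE => //; exact: bd_Omega.
rewrite linearZ /= bd_crossE !scaleN1r opprK opprB addrACA addKr.
by rewrite -(linear_D (crossEl g)) e (linear_Z (crossEl g)) (linear_Z (crossEr u)) scalerDl.
Qed.

End EigBox.

(** * Multiplicities from bases of eigenvectors *)

Section Families.
Variables (R : realType) (V : vectType R) (I : finType) (e : I -> V).

Definition free_family := forall c : I -> R, \sum_i c i *: e i = 0 -> forall i, c i = 0.

Definition in_span (v : V) := exists c : I -> R, v = \sum_i c i *: e i.

Lemma in_span0 : in_span 0.
Proof. by exists (fun=> 0); rewrite big1 // => i _; rewrite scale0r. Qed.

Lemma in_span_lin a u v : in_span u -> in_span v -> in_span (a *: u + v).
Proof.
case=> c -> [d ->]; exists (fun i => a * c i + d i).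
rewrite scaler_sumr -big_split; apply: eq_bigr => i _.
by rewrite scalerDl scalerA.
Qed.

Lemma in_span_mem i : in_span (e i).
Proof.
exists (fun j => (j == i)%:R); rewrite (bigD1 i) //= eqxx scale1r big1 ?addr0 //.
by move=> j /negbTE ->; rewrite scale0r.
Qed.

Lemma in_span_comb (J : finType) (a : J -> R) (v : J -> V) :
  (forall j, in_span (v j)) -> in_span (\sum_j a j *: v j).
Proof.
move=> h; elim/big_rec: _ => [|j w _ hw]; first exact: in_span0.
exact: in_span_lin.
Qed.

(** In a basis of eigenvectors, an eigenspace is spanned by the members of
    the basis that it contains. *)
Lemma mult_family (f : 'End(V)) (mu : I -> R) (a : R) :
  free_family -> (forall v, in_span v) -> (forall i, f (e i) = mu i *: e i) ->
  mult f a = #|[pred i | mu i == a]|.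
Proof.
move=> fr sp ev; set A := [pred i | mu i == a].
pose X := [tuple e (enum_val (i : 'I_#|A|)) | i < #|A|].
have Xi (i : 'I_#|A|) : X`_i = e (enum_val i) by rewrite -tnth_nth tnth_mktuple.
have -> : mult f a = \dim <<X>>%VS.
  rewrite /mult; congr (\dim _); apply/vspaceP => v; apply/idP/idP.
    rewrite memv_ker !lfun_simp => /eqP h.
    have [c vE] := sp v.
    have c0 i : i \notin A -> c i = 0.
      have : \sum_i (c i * (mu i - a)) *: e i = 0.
        rewrite -[RHS]h vE linear_sum scaler_sumr -sumrB; apply: eq_bigr => j _.
        by rewrite linearZ /= ev !scalerA -scalerBl mulrBr [a * _]mulrC.
      move=> /fr/(_ i)/eqP; rewrite mulf_eq0 subr_eq0 => /orP[/eqP //|h2].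
      by rewrite inE h2.
    rewrite vE (bigID (mem A)) /= [X in _ + X]big1 ?addr0 => [|i iA]; last first.
      by rewrite c0 ?scale0r.
    rewrite big_enum_val; apply: memv_suml => i _; apply/memvZ/memv_span.
    by rewrite -Xi mem_nth // size_tuple.
  move=> /coord_span ->; apply: memv_suml => i _; apply: memvZ.
  rewrite Xi memv_ker !lfun_simp ev.
  by have := enum_valP i; rewrite inE => /eqP ->; rewrite subrr.
suff : free X by move/eqP ->; rewrite size_tuple.
apply/freeP => k h i.
(* The coefficients k, extended by 0 from the members of A to all indices. *)
pose c j := \sum_(i' | enum_val i' == j) k i'.
have cE (i' : 'I_#|A|) : c (enum_val i') = k i'.
  rewrite /c (bigD1 i') //= big1 ?addr0 // => i2 /andP[/eqP/enum_val_inj ->].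
  by rewrite eqxx.
have c0 j : j \notin A -> c j = 0.
  move=> jA; rewrite /c big_pred0 // => i'; apply/negP => /eqP e'.
  by move: jA; rewrite -e' enum_valP.
rewrite -cE; apply: fr; rewrite (bigID (mem A)) /= [X in _ + X]big1 ?addr0.
  by rewrite big_enum_val -[RHS]h; apply: eq_bigr => i' _; rewrite cE Xi.
by move=> j jA; rewrite c0 ?scale0r.
Qed.

End Families.

Section Spec.
Variable R : realType.

(** The values of mu with repetitions.  Stating this by sums of arbitrary
    functions lets products and unions of index types follow from
    rearrangements of sums. *)
Definition lists (I : finType) (mu : I -> R) (ls : seq R) :=
  forall F : R -> nat, (\sum_(x <- ls) F x = \sum_i F (mu i))%N.

Definition has_spec (G : digraph) q (ls : seq R) :=
  exists (I : finType) (e : I -> chain R G q) (mu : I -> R),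
  [/\ free_family e, forall u, u \in Omega R G q -> in_span e u,
      forall i, hodge_eigen (e i) (mu i) & lists mu ls].

Definition has_vertex_spec (G : digraph) (ls : seq R) :=
  exists (I : finType) (e : I -> chain R G 1) (mu : I -> R),
  [/\ free_family e, forall u, u \in Omega R G 1 -> in_span e u,
      forall i, eigen_vertex (e i) (mu i) & lists mu ls].

Definition has_edge_spec (G : digraph) (ls : seq R) :=
  exists (I : finType) (e : I -> chain R G 2) (mu : I -> R),
  [/\ free_family e, forall u, u \in Omega R G 2 -> in_span e u,
      forall i, eigen_edge (e i) (mu i) & lists mu ls].

Lemma has_spec_mult (G : digraph) p ls a : has_spec G p.+1 ls ->
  mult (normalized_hodge R G p) a = count_mem a ls.
Proof.
case=> I [e [mu [fr sp ev ml]]].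
rewrite (@mult_family _ _ I (fun i => vsproj (Omega R G p.+1) (e i)) _ mu).
- rewrite -sum1_count -sum1_card.
  by rewrite [LHS]big_mkcond [RHS]big_mkcond /= (ml (fun x => if x == a then 1%N else 0%N)).
- move=> c h; apply: fr.
  have := congr1 vsval h; rewrite linear_sum linear0 => h0; rewrite -[RHS]h0.
  apply: eq_bigr => i _; rewrite linearZ /= vsprojK //.
  exact: hodge_eigen_Omega (ev i).
- move=> v; have [c vE] := sp _ (subvsP v); exists c.
  rewrite -[v]vsvalK vE linear_sum; apply: eq_bigr => i _.
  by rewrite linearZ.
by move=> i; exact: normalized_hodge_eigen.
Qed.

Definition sumset (A S : seq R) := [seq x + y | x <- A, y <- S].

(** Omega_box_ind shows that the products of eigenvectors span.  They are
    free because evaluation on stacks sees only the vertex products,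
    evaluation on elevated paths sees only the arrow products, and both give
    bilinear expressions in free families. *)
Lemma has_spec_box (X Y : digraph) q A B S0 S1 : thin Y ->
  has_spec X q.+1 A -> has_spec X q B -> has_vertex_spec Y S0 -> has_edge_spec Y S1 ->
  has_spec (box X Y) q.+1 (sumset A S0 ++ sumset B S1).
Proof.
move=> Yt [I [e [mu [fe se ee le]]]] [I' [e' [mu' [fe' se' ee' le']]]].
move=> [J [f [lam [ff sf ef lf]]]] [J' [g [lam' [fg sg eg lg]]]].
pose E (k : (I * J) + (I' * J')) : chain R (box X Y) q.+1 :=
  match k with inl (i, j) => crossV (e i) (f j) | inr (i, j) => crossE (e' i) (g j) end.
pose M (k : (I * J) + (I' * J')) : R :=
  match k with inl (i, j) => mu i + lam j | inr (i, j) => mu' i + lam' j end.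
exists ((I * J) + (I' * J'))%type, E, M; split.
- move=> c h.
  have hs s : \sum_i \sum_j c (inl (i, j)) * pcoef (crossV (e i) (f j)) s +
              \sum_i \sum_j c (inr (i, j)) * pcoef (crossE (e' i) (g j)) s = 0.
    transitivity (pcoef (\sum_k c k *: E k) s); last by rewrite h pcoef0.
    by rewrite big_sumType /= pcoefD !pcoef_comb !sum_pair.
  have cV i j : c (inl (i, j)) = 0.
    have : forall v i, \sum_j c (inl (i, j)) * pcoef (f j) [:: v] = 0.
      move=> v; apply: fe; apply: chain_ext => s; rewrite pcoef_comb pcoef0.
      have := hs (stack s v); rewrite [X in _ + X]big1 ?addr0 => [|p _]; last first.
        by rewrite big1 // => p' _; rewrite pcoef_crossE_stack mulr0.
      move=> h0; rewrite -[RHS]h0.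
      apply: eq_bigr => i' _; rewrite mulr_suml; apply: eq_bigr => j' _.
      by rewrite pcoef_crossV_stack; ring.
    move=> hv; apply: (ff (fun j => c (inl (i, j)))); apply: chain_ext => s.
    rewrite pcoef_comb pcoef0; case: s => [|v [|w s]]; last 1 first.
    - by rewrite big1 // => j' _; rewrite pcoef_notpath ?mulr0.
    - by rewrite big1 // => j' _; rewrite pcoef_notpath ?mulr0.
    exact: hv.
  have cE i j : c (inr (i, j)) = 0.
    have : forall v w i, v != w -> \sum_j c (inr (i, j)) * pcoef (g j) [:: v; w] = 0.
      move=> v w i0 vw; move: i0; apply: fe'; apply: chain_ext => s; rewrite pcoef_comb pcoef0.
      case: s => [|x s].
        by rewrite big1 // => i' _; rewrite pcoef_notpath ?mulr0 //; case: (q).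
      have := hs (elevate 0 (x :: s) v w); rewrite big1 ?add0r => [|p _]; last first.
        by rewrite big1 // => p' _; rewrite pcoef_crossV_elevate // mulr0.
      move=> h0; rewrite -[RHS]h0.
      apply: eq_bigr => i' _; rewrite mulr_suml; apply: eq_bigr => j' _.
      by rewrite pcoef_crossE_elevate // expr0 mul1r; ring.
    move=> hv; apply: (fg (fun j => c (inr (i, j)))); apply: chain_ext => s.
    rewrite pcoef_comb pcoef0; case: (boolP [&& size s == 2, (0 < 2)%N & regular s]) => h2.
      case: s h2 => [|v [|w [|z s]]] //.
      by rewrite /regular /= andbT => vw; exact: hv.
    by rewrite big1 // => j' _; rewrite pcoef_notpath ?mulr0.
  by case=> -[].
- apply: (Omega_box_ind Yt) => [||u v uO|u v w uO vw].
  + exact: in_span0.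
  + exact: in_span_lin.
  + have [a ->] := se _ uO; have [b ->] := sf _ (Omega1 (epath R 1 [:: v])).
    rewrite (linear_comb (crossVl _)); apply: in_span_comb => i.
    rewrite (linear_comb (crossVr _)); apply: in_span_comb => j.
    exact: (in_span_mem E (inl (i, j))).
  have vwO : epath R 2 [:: v; w] \in Omega R Y 2.
    by rewrite Omega2E epath_A // /allowed /= vw.
  have [a ->] := se' _ uO; have [b ->] := sg _ vwO.
  rewrite (linear_comb (crossEl _)); apply: in_span_comb => i.
  rewrite (linear_comb (crossEr _)); apply: in_span_comb => j.
  exact: (in_span_mem E (inr (i, j))).
- move=> [[i j]|[i j]].
    exact: hodge_eigen_crossV.
  exact: (hodge_eigen_crossE Yt (ee' i) (eg j)).
move=> F; rewrite big_cat /= /sumset !big_allpairs_dep /= big_sumType /=; congr addn.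
  rewrite (le (fun x => \sum_(y <- S0) F (x + y)%R)%N).
  rewrite (eq_bigr (fun i => \sum_j F (mu i + lam j)%R)%N) => [|i _]; last first.
    exact: (lf (fun y => F (mu i + y)%R)).
  by rewrite pair_bigA /=; apply: eq_bigr => -[].
rewrite (le' (fun x => \sum_(y <- S1) F (x + y)%R)%N).
rewrite (eq_bigr (fun i => \sum_j F (mu' i + lam' j)%R)%N) => [|i _]; last first.
  exact: (lg (fun y => F (mu' i + y)%R)).
by rewrite pair_bigA /=; apply: eq_bigr => -[].
Qed.

End Spec.

(** * The spectral theorem for real symmetric matrices *)

Section Spectral.
Import complex spectral mxred sesquilinear.
Variable R : rcfType.

(** Over the complex numbers the matrix is hermitian, hence similar to a
    diagonal matrix with real entries; two real matrices that are similar over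
    the complex numbers are similar over the reals. *)
Lemma spectral_symmetric n (A : 'M[R]_n) : A^T = A ->
  exists2 P : 'M[R]_n, P \in unitmx &
  exists d : 'rV[R]_n, P *m A = diag_mx d *m P.
Proof.
move=> Asym; pose toC := complex.real_complex R.
pose AC := map_mx toC A.
have ACreal : AC \is a spectral.realmx.
  by apply/mxOverP => i j; rewrite mxE; apply/complex.complex_realP; exists (A i j).
have ACsym : AC \is sesquilinear.symmetricmx.
  by apply/sesquilinear.is_hermitianmxP; rewrite expr0 scale1r;
     apply/matrixP => i j; rewrite !mxE -[in LHS]Asym mxE.
have ACh := spectral.realsym_hermsym ACsym ACreal.
have dreal := spectral.hermitian_spectral_diag_real ACh.
have /spectral.orthomx_spectralP ACE := spectral.hermitian_normalmx ACh.
set d := spectral.spectral_diag AC in dreal ACE.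
set Q := spectral.spectralmx AC in ACE.
have Qu : Q \in unitmx := spectral.spectral_unit AC.
have dR : diag_mx d \is a spectral.realmx.
  apply/mxOverP => i j; rewrite !mxE; case: eqP => _; last by rewrite mulr0n rpred0.
  by rewrite mulr1n (mxOverP dreal).
have sim : mxred.similar_in unitmx AC (diag_mx d).
  exists Q; first exact: Qu.
  apply/(similarP Qu); rewrite [in LHS]ACE -[X in Q *m X = _]mulmxA; exact: mulKVmx.
have [P /andP[Preal Pu] /mxred.similarP PE] := spectral.real_similar sim ACreal dR.
pose re (M : 'M[complex.complex R]_n) := map_mx (@complex.Re R) M.
have reK (m1 m2 : nat) (M : 'M[complex.complex R]_(m1, m2)) : M \is a spectral.realmx ->
    map_mx toC (map_mx (@complex.Re R) M) = M.
  by move=> Mr; apply/matrixP => i j; rewrite !mxE; exact/RRe_real/(mxOverP Mr).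
exists (map_mx (@complex.Re R) P).
  by rewrite -(map_unitmx toC) reK.
exists (map_mx (@complex.Re R) d); apply: (map_mx_inj (f := toC)).
by rewrite !map_mxM map_diag_mx !reK // PE.
Qed.

End Spectral.

(** * The Laplacians of a single factor *)

Section MultComp.
Variables (R : realType).

(** On this eigenspace k undoes h up to the factor a, so h is injective; and
    it maps into the eigenspace of the other composite. *)
Lemma mult_comp_le (U V : vectType R) (h : 'Hom(U, V)) (k : 'Hom(V, U)) a :
  a != 0 -> (mult (k \o h)%VF a <= mult (h \o k)%VF a)%N.
Proof.
move=> a0; rewrite /mult; set E := passmx.leigenspace (k \o h)%VF a.
have hE u : u \in E -> k (h u) = a *: u.
  by rewrite memv_ker !lfun_simp subr_eq0 => /eqP.
have kE : (E :&: lker h = 0)%VS.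
  apply/eqP; rewrite -subv0; apply/subvP => u.
  rewrite memv_cap memv_ker => /andP[/hE e /eqP hu].
  by move/eqP: e; rewrite hu linear0 eq_sym scaler_eq0 (negbTE a0) memv0.
rewrite -(limg_dim_eq kE); apply: dimvS; apply/subvP => _ /memv_imgP[u /hE e ->].
by rewrite memv_ker !lfun_simp /= e linearZ subrr.
Qed.

Lemma mult_comp (U V : vectType R) (h : 'Hom(U, V)) (k : 'Hom(V, U)) a :
  a != 0 -> mult (k \o h)%VF a = mult (h \o k)%VF a.
Proof. by move=> a0; apply/eqP; rewrite eqn_leq !mult_comp_le. Qed.

Lemma free_family_map (V W : vectType R) (I : finType) (e : I -> V) (h : V -> W) :
  linear h -> injective h -> free_family e -> free_family (fun i => h (e i)).
Proof.
move=> hl hi fe c; rewrite -(linear_comb hl) -(linear_0 hl) => /hi; exact: fe.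
Qed.

Lemma in_span_map (V W : vectType R) (I : finType) (e : I -> V) (h : V -> W) v :
  linear h -> in_span e v -> in_span (fun i => h (e i)) (h v).
Proof. by move=> hl [c ->]; exists c; rewrite (linear_comb hl). Qed.

Lemma free_family_neq0 (V : vectType R) (I : finType) (e : I -> V) i :
  free_family e -> e i != 0.
Proof.
move=> fe; apply/eqP => e0; have := fe (fun j => (j == i)%:R).
rewrite (bigD1 i) //= e0 scaler0 add0r big1 => [/(_ erefl i)/eqP|j /negbTE ->].
  by rewrite eqxx oner_eq0.
by rewrite scale0r.
Qed.

Lemma free_rows n (P : 'M[R]_n) : P \in unitmx -> free_family (fun i => row i P).
Proof.
move=> Pu c h i; have e : (\row_j c j) *m P = 0.
  by rewrite mulmx_sum_row -[RHS]h; apply: eq_bigr => j _; rewrite mxE.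
have /rowP/(_ i) : \row_j c j = 0 by rewrite -(mulmxK Pu (\row_j c j)) e mul0mx.
by rewrite !mxE.
Qed.

Lemma span_rows n (P : 'M[R]_n) x : P \in unitmx -> in_span (fun i => row i P) x.
Proof.
move=> Pu; exists (fun i => (x *m invmx P) 0 i).
by rewrite -mulmx_sum_row mulmxKV.
Qed.

Lemma dot_ge0 n (x : 'rV[R]_n) : 0 <= (x *m x^T) 0 0.
Proof. by rewrite mxE; apply: sumr_ge0 => i _; rewrite mxE -expr2 sqr_ge0. Qed.

Lemma dot_eq0 n (x : 'rV[R]_n) : (x *m x^T) 0 0 = 0 -> x = 0.
Proof.
rewrite mxE => /eqP; rewrite psumr_eq0 => [/allP h|i _]; last by rewrite mxE -expr2 sqr_ge0.
apply/rowP => i; have := h i (mem_index_enum i).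
by rewrite !mxE mulf_eq0 orbb => /eqP.
Qed.

End MultComp.

Section Base.
Variables (R : realType) (G : digraph).
Let nv := #|G|.
Let na := #|arrows G|.
Let src (k : 'I_na) : G := (enum_val k).1.
Let tgt (k : 'I_na) : G := (enum_val k).2.

Definition incidence : 'M[R]_(na, nv) :=
  \matrix_(k, i) ((enum_val i == tgt k)%:R - (enum_val i == src k)%:R).
Let B := incidence.

Definition vchain (x : 'rV[R]_nv) : chain R G 1 :=
  \sum_i x 0 i *: epath R 1 [:: enum_val i].

Definition echain (y : 'rV[R]_na) : chain R G 2 :=
  \sum_k y 0 k *: epath R 2 [:: src k; tgt k].

Lemma vchain_lin : linear vchain.
Proof.
move=> a x y; rewrite /vchain scaler_sumr -big_split; apply: eq_bigr => i _.
by rewrite !mxE scalerDl scalerA.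
Qed.

Lemma echain_lin : linear echain.
Proof.
move=> a x y; rewrite /echain scaler_sumr -big_split; apply: eq_bigr => i _.
by rewrite !mxE scalerDl scalerA.
Qed.

Lemma arrow_enum (k : 'I_na) : arrow (src k) (tgt k).
Proof. by have := enum_valP k; rewrite inE. Qed.

Lemma src_neq_tgt (k : 'I_na) : src k != tgt k.
Proof. by have := arrow_enum k; apply: contraTneq => ->; rewrite arrow_irr. Qed.

Lemma pcoef_vchain x (i : 'I_nv) : pcoef (vchain x) [:: enum_val i] = x 0 i.
Proof.
rewrite pcoef_comb (bigD1 i) //= big1 ?addr0 => [|j ji].
  by rewrite pcoef_epath eqxx mulr1.
rewrite pcoef_epath eqseq_cons andbT.
case: (enum_val j =P enum_val i) => [/enum_val_inj e|_].
  by rewrite e eqxx in ji.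
by rewrite andbF mulr0.
Qed.

Lemma pcoef_echain y (k : 'I_na) : pcoef (echain y) [:: src k; tgt k] = y 0 k.
Proof.
have e2 (j : 'I_na) : pcoef (epath R 2 [:: src j; tgt j]) [:: src k; tgt k] = (j == k)%:R.
  rewrite pcoef_epath /= src_neq_tgt !eqseq_cons !eqxx !andbT /=.
  congr (_%:R : R); congr nat_of_bool.
  apply/andP/eqP => [[/eqP e1 /eqP e2]|-> //].
  apply: enum_val_inj.
  by rewrite [LHS]surjective_pairing [RHS]surjective_pairing; congr pair.
rewrite pcoef_comb (bigD1 k) //= big1 ?addr0 => [|j ji]; first by rewrite e2 eqxx mulr1.
by rewrite e2 (negbTE ji) mulr0.
Qed.

Lemma vchain_inj : injective vchain.
Proof. by move=> x y e; apply/rowP => i; rewrite -!pcoef_vchain e. Qed.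

Lemma echain_inj : injective echain.
Proof. by move=> x y e; apply/rowP => i; rewrite -!pcoef_echain e. Qed.

Lemma vchain_surj f : exists x, f = vchain x.
Proof.
exists (\row_i pcoef f [:: enum_val i]); apply: chain_ext => s.
case: s => [|v [|w s]]; [by rewrite !pcoef_notpath | | by rewrite !pcoef_notpath].
by rewrite -(enum_rankK v) pcoef_vchain mxE.
Qed.

Lemma echain_surj g : g \in Omega R G 2 -> exists y, g = echain y.
Proof.
rewrite Omega2E => /AspaceP gA.
exists (\row_k pcoef g [:: src k; tgt k]); apply: chain_ext => s.
case: (boolP (allowed s)) => sA; last first.
  rewrite gA // pcoef_comb big1 // => k _; rewrite pcoef_epath.
  case: (_ =P s) => [e|_]; last by rewrite andbF mulr0.
  by move: sA; rewrite -e /allowed /= arrow_enum.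
case: s sA => [|v [|w [|z s]]] sA;
  [by rewrite !pcoef_notpath | by rewrite !pcoef_notpath | | by rewrite !pcoef_notpath].
have vwA : (v, w) \in arrows G by move: sA; rewrite /allowed /= andbT inE.
have e : enum_val (enum_rank_in vwA (v, w)) = (v, w) by rewrite enum_rankK_in.
have := pcoef_echain (\row_k pcoef g [:: src k; tgt k]) (enum_rank_in vwA (v, w)).
by rewrite mxE /src /tgt e.
Qed.

Lemma echain_Omega y : echain y \in Omega R G 2.
Proof.
apply: memv_suml => k _; apply: memvZ; rewrite Omega2E epath_A //.
by rewrite /allowed /= arrow_enum.
Qed.

Lemma sum_enum_val (V : lmodType R) (F : G -> V) (v : G) :
  \sum_(i < nv) (enum_val i == v)%:R *: F (enum_val i) = F v.
Proof.
rewrite (bigD1 (enum_rank v)) //= enum_rankK eqxx scale1r big1 ?addr0 // => i iv.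
case: eqP => [e|_]; last by rewrite scale0r.
by rewrite -e enum_valK eqxx in iv.
Qed.

Lemma bd_echain y : bd R G 1 (echain y) = vchain (y *m B).
Proof.
rewrite /echain linear_sum /= [vchain _](_ : _ = \sum_k y 0 k *: vchain (row k B)); last first.
  by rewrite mulmx_sum_row (linear_comb vchain_lin).
apply: eq_bigr => k _; rewrite linearZ /= bd_edge; congr (_ *: _).
rewrite /vchain; under eq_bigr do rewrite !mxE scalerBl.
by rewrite sumrB !(sum_enum_val (fun v => epath R 1 [:: v])).
Qed.

Lemma dotc_vchain x x' : dotc (vchain x) (vchain x') = (x *m x'^T) 0 0.
Proof.
rewrite [X in dotc _ X]/vchain dotc_sumr mxE; apply: eq_bigr => i _.
by rewrite -/(pcoef _ _) pcoef_vchain mxE mulrC.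
Qed.

Lemma dotc_echain y y' : dotc (echain y) (echain y') = (y *m y'^T) 0 0.
Proof.
rewrite [X in dotc _ X]/echain dotc_sumr mxE; apply: eq_bigr => i _.
by rewrite -/(pcoef _ _) pcoef_echain mxE mulrC.
Qed.

Lemma ndot1 (f f' : chain R G 1) : ndot f f' = dotc f f'.
Proof. by rewrite /ndot fact0 invr1 mul1r. Qed.

Lemma ndot2 (f f' : chain R G 2) : ndot f f' = dotc f f'.
Proof. by rewrite /ndot (_ : (2.-1)`! = 1)%N // invr1 mul1r. Qed.

Lemma cobd_vchain x : cobd (vchain x) (echain (x *m B^T)).
Proof.
split=> [|t /echain_surj[y ->]]; first exact: echain_Omega.
by rewrite ndot1 ndot2 bd_echain dotc_vchain dotc_echain trmx_mul trmxK mulmxA.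
Qed.

Lemma eigen_vertex_vchain (x : 'rV[R]_nv) lam :
  x *m B^T *m B = lam *: x -> eigen_vertex (vchain x) lam.
Proof.
move=> e; exists (echain (x *m B^T)); first exact: cobd_vchain.
by rewrite bd_echain e (linear_Z vchain_lin).
Qed.

Lemma eigen_edge_echain (y : 'rV[R]_na) lam :
  y *m B *m B^T = lam *: y -> eigen_edge (echain y) lam.
Proof.
move=> e; split; first exact: echain_Omega.
by rewrite bd_echain -(linear_Z echain_lin) -e; exact: cobd_vchain.
Qed.

Lemma mul_incidenceT (x : 'rV[R]_nv) k :
  (x *m B^T) 0 k = x 0 (enum_rank (tgt k)) - x 0 (enum_rank (src k)).
Proof.
rewrite mxE; under eq_bigr do rewrite !mxE mulrBr ![_ * (_ == _)%:R]mulrC.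
rewrite sumrB.
have h (v : G) : \sum_(i < nv) (enum_val i == v)%:R * x 0 i = x 0 (enum_rank v).
  rewrite -(sum_enum_val (fun v => x 0 (enum_rank v) : R^o)).
  by apply: eq_bigr => i _; rewrite enum_valK.
by rewrite !h.
Qed.

Hypothesis Gconn : connected G.

(** The square norm of x B^T is x B^T B x^T = 0, so x takes the same value at
    both ends of every arrow, and connectedness spreads this value. *)
Lemma ker_laplacian (x : 'rV[R]_nv) :
  x *m B^T *m B = 0 -> forall i j, x 0 i = x 0 j.
Proof.
move=> h.
have e : x *m B^T = 0.
  apply: dot_eq0; rewrite trmx_mul trmxK mulmxA h mul0mx mxE //.
have step u v : arrow u v -> x 0 (enum_rank u) = x 0 (enum_rank v).
  move=> uv; have uvA : (u, v) \in arrows G by rewrite inE.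
  have := mul_incidenceT x (enum_rank_in uvA (u, v)).
  rewrite e mxE /src /tgt enum_rankK_in //= => /eqP.
  by rewrite eq_sym subr_eq0 => /eqP.
have walk p u v : path [rel a b : G | arrow a b || arrow b a] u p -> v = last u p ->
    x 0 (enum_rank u) = x 0 (enum_rank v).
  elim: p u => [|w p ih] u /=; first by move=> _ ->.
  case/andP=> uw wp vE; transitivity (x 0 (enum_rank w)); last exact: ih.
  by case/orP: uw => /step.
move=> i j; have /connectP[p hp vE] := Gconn (enum_val i) (enum_val j).
by have := walk p _ _ hp vE; rewrite !enum_valK.
Qed.

(** In the bases of vertices and arrows the two Laplacians are B^T B and
    B B^T; mult_comp compares their nonzero eigenvalues, and ker_laplacian
    identifies the kernel of the first with the constants. *)
Theorem base_spectra : exists (S0 S1 : seq R),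
  [/\ has_vertex_spec G S0, has_edge_spec G S1, size S0 = #|G| & size S1 = #|arrows G|] /\
  [/\ forall a, a \in S0 -> 0 <= a, (0 < #|G|)%N -> count_mem 0 S0 = 1%N
    & forall a, a != 0 -> count_mem a S0 = count_mem a S1].
Proof.
have [P Pu [d PE]] : exists2 P : 'M[R]_nv, P \in unitmx &
  exists d : 'rV[R]_nv, P *m (B^T *m B) = diag_mx d *m P.
  by apply: spectral_symmetric; rewrite trmx_mul trmxK.
have [Q Qu [d' QE]] : exists2 P : 'M[R]_na, P \in unitmx &
  exists d : 'rV[R]_na, P *m (B *m B^T) = diag_mx d *m P.
  by apply: spectral_symmetric; rewrite trmx_mul trmxK.
have Pi i : row i P *m B^T *m B = d 0 i *: row i P.
  by rewrite -mulmxA -row_mul PE row_mul row_diag_mx -scalemxAl -rowE.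
have Qi i : row i Q *m B *m B^T = d' 0 i *: row i Q.
  by rewrite -mulmxA -row_mul QE row_mul row_diag_mx -scalemxAl -rowE.
exists [seq d 0 i | i <- enum 'I_nv], [seq d' 0 i | i <- enum 'I_na].
pose h := linfun (mulmxr B^T : 'rV[R]_nv -> 'rV[R]_na).
pose k := linfun (mulmxr B : 'rV[R]_na -> 'rV[R]_nv).
have c0 a : count_mem a [seq d 0 i | i <- enum 'I_nv] = mult (k \o h)%VF a.
  rewrite (@mult_family _ _ _ (fun i => row i P) _ (fun i => d 0 i)).
  - rewrite count_map cardE -size_filter /enum_mem -filter_predI; congr size.
    by apply: eq_filter => i; rewrite /= inE andbT.
  - exact: free_rows.
  - by move=> v; exact: span_rows.
  by move=> i; rewrite !lfun_simp /= Pi.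
have c1 a : count_mem a [seq d' 0 i | i <- enum 'I_na] = mult (h \o k)%VF a.
  rewrite (@mult_family _ _ _ (fun i => row i Q) _ (fun i => d' 0 i)).
  - rewrite count_map cardE -size_filter /enum_mem -filter_predI; congr size.
    by apply: eq_filter => i; rewrite /= inE andbT.
  - exact: free_rows.
  - by move=> v; exact: span_rows.
  by move=> i; rewrite !lfun_simp /= Qi.
split; split.
- exists 'I_nv, (fun i => vchain (row i P)), (fun i => d 0 i); split.
  + exact/free_family_map/free_rows/Pu/vchain_inj/vchain_lin.
  + move=> u _; have [x ->] := vchain_surj u.
    exact/in_span_map/span_rows/Pu/vchain_lin.
  + by move=> i; exact: eigen_vertex_vchain.
  by move=> F; rewrite big_map big_enum.
- exists 'I_na, (fun i => echain (row i Q)), (fun i => d' 0 i); split.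
  + exact/free_family_map/free_rows/Qu/echain_inj/echain_lin.
  + move=> u /echain_surj [x ->].
    exact/in_span_map/span_rows/Qu/echain_lin.
  + by move=> i; exact: eigen_edge_echain.
  by move=> F; rewrite big_map big_enum.
- by rewrite size_map size_enum_ord.
- by rewrite size_map size_enum_ord.
- move=> _ /mapP[i _ ->].
  have xP : 0 < (row i P *m (row i P)^T) 0 0.
    rewrite lt_neqAle dot_ge0 andbT eq_sym; apply/eqP => /dot_eq0/eqP.
    by rewrite (negbTE (free_family_neq0 i (free_rows Pu))).
  have := dot_ge0 (row i P *m B^T).
  rewrite trmx_mul trmxK mulmxA Pi -scalemxAl mxE => h0.
  by rewrite -(pmulr_lge0 _ xP).
- move=> G0; rewrite c0.
  have -> : mult (k \o h)%VF 0 = \dim <[const_mx 1 : 'rV[R]_nv]>%VS.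
    congr (\dim _); apply/vspaceP => x; rewrite memv_ker !lfun_simp scale0r subr0 /=.
    apply/eqP/vlineP => [/ker_laplacian hx|[a ->]].
      exists (x 0 (Ordinal G0)); apply/rowP => i; rewrite !mxE mulr1; exact: hx.
    have -> : a *: (const_mx 1 : 'rV[R]_nv) *m B^T = 0.
      by apply/rowP => j; rewrite mul_incidenceT !mxE subrr.
    by rewrite mul0mx.
  have n0 : (const_mx 1 : 'rV[R]_nv) != 0.
    apply/eqP => /rowP/(_ (Ordinal G0)); rewrite !mxE => /eqP.
    by rewrite oner_eq0.
  by rewrite dim_vline n0.
by move=> a a0; rewrite c0 c1 mult_comp.
Qed.

End Base.

(** * Eigenvalue lists of Cartesian powers *)

Section BoxPower.
Variable R : realType.
Implicit Types S : seq R.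

(** The first three vertices of an allowed path leave a gap with a single
    filling. *)
Lemma Omega_thin_eq0 (G : digraph) q (w : chain R G q.+3) : thin G ->
  w \in Omega R G q.+3 -> w = 0.
Proof.
move=> Gt wO; have [wA h] := OmegaP _ wO; apply: chain_ext => s; rewrite pcoef0.
case: (boolP (allowed s)) => [sA|]; last exact: wA.
case: s sA => [|b [|c [|d s]]] sA; try exact: pcoef_notpath.
have bc : arrow b c := @allowed_cat2 G [::] b c (d :: s) sA.
have cd : arrow c d := @allowed_cat2 G [:: b] c d s sA.
have [bd nbd bcd] := Gt _ _ _ bc cd.
have := h [::] b d s nbd bd; rewrite (bigD1 c) //= big1 ?addr0 // => m mc.
apply: wA; apply: contra mc => mA; apply/eqP/bcd.
  exact: (@allowed_cat2 G [::] b m (d :: s) mA).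
exact: (@allowed_cat2 G [:: b] m d s mA).
Qed.

Lemma has_spec_nil (G : digraph) q :
  (forall u, u \in Omega R G q -> u = 0) -> has_spec G q (@nil R).
Proof.
move=> h; exists 'I_0, (fun=> 0), (fun=> 0); split.
- by move=> c _ [].
- by move=> u /h ->; exact: in_span0.
- by case.
by move=> F; rewrite big_nil big_ord0.
Qed.

Lemma has_spec_vertex (G : digraph) S : has_vertex_spec G S -> has_spec G 1 S.
Proof.
case=> I [e [mu [fr sp ev ls]]]; exists I, e, mu; split=> // i.
have [df hf ef] := ev i; split; first exact: Omega1.
exists df, 0; split=> //; last by rewrite addr0.
by rewrite (chain_deg0 (bd _ _ _ _)); exact: cobd0.
Qed.

Lemma has_spec_edge (G : digraph) S : thin G ->
  has_edge_spec G S -> has_spec G 2 S.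
Proof.
move=> Gt [I [e [mu [fr sp ev ls]]]]; exists I, e, mu; split=> // i.
have [gO hg] := ev i; split=> //.
exists 0, (mu i *: e i); split=> //; last by rewrite linear0 add0r.
split=> [|t /(Omega_thin_eq0 Gt) ->]; first exact: mem0v.
by rewrite linear0 !ndot0l.
Qed.

Variables S0 S1 : seq R.

(** Adding a factor either adds a vertex eigenvalue and keeps the degree, or
    adds an arrow eigenvalue and raises the degree by one. *)
Fixpoint spectra n r : seq R :=
  if n is n'.+1 then
    sumset (spectra n' r) S0 ++
    (if r is r'.+1 then sumset (spectra n' r') S1 else [::])
  else if r is 0 then [:: 0] else [::].

Lemma sumset0 (S : seq R) : sumset [:: 0] S = S.
Proof.
by rewrite /sumset /= cats0 -[RHS]map_id; apply: eq_map => x; rewrite add0r.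
Qed.

Lemma has_spec_pow (G : digraph) n r : thin G ->
  has_vertex_spec G S0 -> has_edge_spec G S1 ->
  has_spec (box_pow G n.+1) r.+1 (spectra n.+1 r).
Proof.
move=> Gt hV hE; elim: n r => [|n ih] r.
  rewrite /box_pow /=; case: r => [|[|r]] /=.
  - by rewrite sumset0 cats0; exact: has_spec_vertex.
  - by rewrite sumset0; exact: has_spec_edge.
  by apply: has_spec_nil => u; exact: Omega_thin_eq0.
rewrite -[box_pow G n.+2]/(box (box_pow G n.+1) G).
case: r => [|r]; last exact: has_spec_box.
rewrite -[spectra _ _]/(sumset (spectra n.+1 0) S0 ++ sumset [::] S1).
apply: has_spec_box => //; apply: has_spec_nil => u _; exact: chain_deg0.
Qed.

End BoxPower.

(** * Counting sums of eigenvalues *)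

Section Sums.
Variable R : realType.
Implicit Types (A S T : seq R) (F : R -> nat).

Lemma sum_sumset A S F :
  (\sum_(z <- sumset A S) F z = \sum_(y <- S) \sum_(x <- A) F (x + y)%R)%N.
Proof. by rewrite /sumset big_allpairs_dep exchange_big. Qed.

(** All sums of j terms from T, with repetitions. *)
Fixpoint nfold T j : seq R := if j is j'.+1 then sumset (nfold T j') T else [:: 0].

Lemma pascal_sum n (f : nat -> nat) :
  (\sum_(j < n.+1) 'C(n, j) * (f j + f j.+1) = \sum_(j < n.+2) 'C(n.+1, j) * f j)%N.
Proof.
rewrite [RHS]big_ord_recl bin0 mul1n.
under [X in (_ + X)%N]eq_bigr do rewrite lift0 binS mulnDl.
rewrite big_split /= [X in (_ + (X + _))%N]big_ord_recr /= bin_small // mul0n addn0 addnA.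
under [LHS]eq_bigr do rewrite mulnDr.
rewrite big_split /=; congr addn.
by rewrite big_ord_recl bin0 mul1n.
Qed.

(** Arrows and vertices have the same eigenvalues, so the positions of the r
    arrows are chosen independently of the j positions with an eigenvalue
    from T. *)
Lemma sum_spectra_cycle S0 S1 T n r F : perm_eq S0 (0 :: T) -> perm_eq S1 (0 :: T) ->
  (\sum_(x <- spectra S0 S1 n r) F x =
   \sum_(j < n.+1) 'C(n, j) * ('C(n, r) * \sum_(z <- nfold T j) F z))%N.
Proof.
move=> p0 p1; elim: n r F => [|n ih] r F.
  rewrite big_ord_recl big_ord0 addn0 /= bin0 mul1n.
  by case: r => [|r]; rewrite ?bin0 ?mul1n // big_nil bin0n mul0n.
have step r' : (\sum_(y <- 0%R :: T) \sum_(x <- spectra S0 S1 n r') F (x + y)%R =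
   'C(n, r') * \sum_(j < n.+2) 'C(n.+1, j) * \sum_(z <- nfold T j) F z)%N.
  rewrite -(pascal_sum n (fun j => \sum_(z <- nfold T j) F z)%N).
  rewrite (eq_bigr _ (fun y _ => ih r' (fun x => F (x + y)))).
  rewrite exchange_big big_distrr /=; apply: eq_bigr => j _.
  rewrite -!big_distrr /= mulnCA; congr (_ * (_ * _))%N.
  rewrite big_cons /= sum_sumset; congr addn.
  by apply: eq_bigr => x _; rewrite addr0.
rewrite /= big_cat /= sum_sumset (perm_big _ p0) /= step.
transitivity ('C(n.+1, r) * \sum_(j < n.+2) 'C(n.+1, j) * \sum_(z <- nfold T j) F z)%N.
  case: r => [|r]; first by rewrite big_nil addn0 !bin0.
  by rewrite sum_sumset (perm_big _ p1) /= step binS mulnDl.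
by rewrite big_distrr; apply: eq_bigr => j _; rewrite mulnCA.
Qed.

(** Arrows have eigenvalues from T only, so the r positions of the arrows are
    chosen among the j positions with an eigenvalue from T. *)
Lemma sum_spectra_tree S0 S1 T n r F : perm_eq S0 (0 :: T) -> perm_eq S1 T ->
  (\sum_(x <- spectra S0 S1 n r) F x =
   \sum_(j < n.+1) 'C(n, j) * ('C(j, r) * \sum_(z <- nfold T j) F z))%N.
Proof.
move=> p0 p1; elim: n r F => [|n ih] r F.
  rewrite big_ord_recl big_ord0 addn0 /= bin0 mul1n.
  by case: r => [|r]; rewrite ?bin0 ?mul1n // big_nil bin0n mul0n.
pose N j := (\sum_(z <- nfold T j) F z)%N.
have step r' : (\sum_(y <- T) \sum_(x <- spectra S0 S1 n r') F (x + y)%R =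
   \sum_(j < n.+1) 'C(n, j) * ('C(j, r') * N j.+1))%N.
  rewrite (eq_bigr _ (fun y _ => ih r' (fun x => F (x + y)))).
  rewrite exchange_big /=; apply: eq_bigr => j _.
  by rewrite -!big_distrr /N /= sum_sumset.
rewrite /= big_cat /= sum_sumset (perm_big _ p0) /= big_cons /= step.
under eq_bigr do rewrite addr0.
rewrite ih -(pascal_sum n (fun j => 'C(j, r) * N j)%N) -addnA.
transitivity (\sum_(j < n.+1) 'C(n, j) * ('C(j, r) * N j) +
   \sum_(j < n.+1) 'C(n, j) * ('C(j.+1, r) * N j.+1))%N.
  congr addn; case: r => [|r].
    by rewrite big_nil addn0; apply: eq_bigr => j _; rewrite !bin0.
  rewrite sum_sumset (perm_big _ p1) /= step -big_split; apply: eq_bigr => j _ /=.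
  by rewrite binS mulnDl mulnDr.
by rewrite -big_split; apply: eq_bigr => j _ /=; rewrite -mulnDr.
Qed.

End Sums.

Section Words.
Variable s : nat.
Implicit Types (w : seq 'I_s).

Fixpoint words j : seq (seq 'I_s) :=
  if j is j'.+1 then [seq i :: w | i <- enum 'I_s, w <- words j'] else [:: [::]].

Definition has_type (k : 'I_s -> nat) w := [forall i, count_mem i w == k i].

Lemma size_words j w : w \in words j -> size w = j.
Proof.
elim: j w => [|j ih] w /=; first by rewrite inE => /eqP ->.
by case/allpairsP => -[i w'] [_ /ih /= e ->] /=; rewrite e.
Qed.

Lemma sum_count w : (\sum_i count_mem i w = size w)%N.
Proof.
elim: w => [|i w ih] /=; first by rewrite big1.
rewrite big_split /= ih (bigD1 i) //= eqxx big1 // => j.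
by rewrite eq_sym => /negbTE ->.
Qed.

Lemma prod_count (m : 'I_s -> nat) w :
  (\prod_(i <- w) m i = \prod_i m i ^ count_mem i w)%N.
Proof.
elim: w => [|i w ih]; first by rewrite big_nil big1.
rewrite big_cons ih /=; under [RHS]eq_bigr do rewrite expnD.
rewrite big_split /=; congr muln.
rewrite (bigD1 i) //= eqxx expn1 big1 ?muln1 // => j.
by rewrite eq_sym => /negbTE ->.
Qed.

Lemma sumr_count (R : realType) (lam : 'I_s -> R) w :
  \sum_(i <- w) lam i = \sum_i (count_mem i w)%:R * lam i.
Proof.
elim: w => [|i w ih]; first by rewrite big_nil big1 // => i _; rewrite mul0r.
rewrite big_cons ih /=; under [RHS]eq_bigr do rewrite natrD mulrDl.
rewrite big_split /=; congr (_ + _).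
rewrite (bigD1 i) //= eqxx mul1r big1 ?addr0 // => j.
by rewrite eq_sym => /negbTE ->; rewrite mul0r.
Qed.

(** Induction by the first letter: the words of type k that begin with i
    contribute k i * j!, and the k i add up to j + 1. *)
Lemma count_words j (k : 'I_s -> nat) : (\sum_i k i = j)%N ->
  (count (has_type k) (words j) * \prod_i (k i)`! = j`!)%N.
Proof.
elim: j k => [|j ih] k kj.
  have k0 i : k i = 0%N.
    by apply/eqP; rewrite -leqn0 -kj (bigD1 i) //= leq_addr.
  rewrite /= big1 ?muln1 => [|i _]; last by rewrite k0.
  by rewrite (_ : has_type k [::]) //; apply/forallP => i; rewrite k0.
rewrite -sum1_count /= big_mkcond big_allpairs_dep big_enum /= big_distrl /=.
rewrite factS -kj big_distrl /=; apply: eq_bigr => i _; rewrite -big_mkcond /=.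
case ki : (k i) => [|d].
  rewrite mul0n big_pred0 // => w; apply/negP => /forallP/(_ i).
  by rewrite /= eqxx ki.
(* the type of the word without its first letter *)
pose k' i' := if i' == i then d else k i'.
have k'i : k' i = d by rewrite /k' eqxx.
have k'n i' : i' != i -> k' i' = k i' by move=> h; rewrite /k' (negbTE h).
have sk : (\sum_i' k' i' = j)%N.
  move: kj; rewrite (bigD1 i) //= ki addSn => -[<-].
  rewrite (bigD1 i) //= k'i; congr addn; apply: eq_bigr => i' h; exact: k'n.
have := ih _ sk; rewrite [X in (_ * X)%N = _](bigD1 i) //= k'i => ihE.
rewrite [X in (_ * X)%N](bigD1 i) //= ki factS -[RHS]/(d.+1 * j`!)%N -ihE.
rewrite (eq_bigr (fun i' => (k' i')`!)) => [|i' h]; last by rewrite k'n.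
rewrite sum1_count -mulnA mulnCA; congr (_ * (_ * _))%N.
apply: eq_count => w; apply: eq_forallb => i' /=.
by rewrite /k' [i == _]eq_sym; case: (eqVneq i' i) => [->|_]; rewrite ?ki.
Qed.

Lemma multinomE n (k : 'I_s -> nat) : (\sum_i k i <= n)%N ->
  multinom n k = ('C(n, \sum_i k i) * count (has_type k) (words (\sum_i k i)))%N.
Proof.
move=> kn; rewrite /multinom.
have := bin_fact kn; rewrite -(count_words (erefl _)) => <-.
rewrite [X in (X %/ _)%N](_ : _ = ('C(n, \sum_i k i) * count (has_type k) (words (\sum_i k i))
  * (\prod_i (k i)`! * (n - \sum_i k i)`!))%N); last by rewrite !mulnA.
by rewrite mulnK // muln_gt0 fact_gt0 andbT prodn_gt0 // => i; rewrite fact_gt0.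
Qed.

Variables (R : realType) (lam : 'I_s -> R) (m : 'I_s -> nat).

Definition blocks : seq R := flatten [seq nseq (m i) (lam i) | i <- enum 'I_s].

Lemma sum_blocks (F : R -> nat) : (\sum_(y <- blocks) F y = \sum_i m i * F (lam i))%N.
Proof.
rewrite /blocks big_flatten big_map big_enum /=; apply: eq_bigr => i _.
by rewrite big_nseq iter_addn_0 mulnC.
Qed.

Lemma sum_nfold j (F : R -> nat) : (\sum_(z <- nfold blocks j) F z =
  \sum_(w <- words j) (\prod_(i <- w) m i) * F (\sum_(i <- w) lam i)%R)%N.
Proof.
elim: j F => [|j ih] F /=; first by rewrite !big_seq1 !big_nil mul1n.
rewrite sum_sumset sum_blocks big_allpairs_dep big_enum /=; apply: eq_bigr => i _.
rewrite ih big_distrr; apply: eq_bigr => w _ /=.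
by rewrite !big_cons mulnA addrC.
Qed.

(** Both the weight and the sum of a word depend on its type only. *)
Lemma sum_nfold_types n j (F : R -> nat) : (j <= n)%N ->
  (\sum_(z <- nfold blocks j) F z =
   \sum_(k : {ffun 'I_s -> 'I_n.+1} | \sum_i k i == j)
     count (has_type (fun i => k i)) (words j) *
     (\prod_i m i ^ k i * F (\sum_i (k i)%:R * lam i)%R))%N.
Proof.
move=> jn; rewrite sum_nfold.
pose ty w : {ffun 'I_s -> 'I_n.+1} := [ffun i => inord (count_mem i w)].
have tyE w : w \in words j -> forall i, ty w i = count_mem i w :> nat.
  move=> /size_words sw i; rewrite ffunE inordK // ltnS (leq_trans _ jn) // -sw.
  exact: count_size.
rewrite big_seq (partition_big ty
  (fun k : {ffun 'I_s -> 'I_n.+1} => (\sum_i k i == j)%N)) /=; last first.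
  move=> w wj; rewrite (eq_bigr _ (fun i _ => tyE w wj i)) sum_count.
  by rewrite (size_words wj).
apply: eq_bigr => k _; rewrite -sum1_count big_distrl /=.
rewrite [RHS]big_seq_cond; apply: eq_big => [w|w /andP[wj /eqP wk]].
  case: (boolP (w \in words j)) => //= wj.
  apply/eqP/forallP => [<- i|h]; first by rewrite tyE.
  by apply/ffunP => i; apply/val_inj; rewrite /= tyE // (eqP (h i)).
have ck i : count_mem i w = k i by rewrite -(tyE w wj) wk.
rewrite mul1n prod_count sumr_count.
by congr (_ * F _)%N; apply: eq_bigr => i _; rewrite ck.
Qed.

(** Both sides are sorted by the number j of factors with an eigenvalue
    in the list of blocks; 'C(n, j) times the number of words of type k is the
    multinomial coefficient of k. *)
Lemma count_multiset n r0 (W : nat -> nat) (a : R) (ls : seq R) :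
  (forall j, (j < r0)%N -> W j = 0%N) ->
  (forall F, \sum_(x <- ls) F x =
    \sum_(j < n.+1) 'C(n, j) * (W j * \sum_(z <- nfold blocks j) F z))%N ->
  count_mem a (multiset_of n r0 (fun k => \sum_i (k i)%:R * lam i)
    (fun k => \prod_i m i ^ k i * multinom n k * W (\sum_i k i))%N) =
  count_mem a ls.
Proof.
move=> W0 hls; pose F x := nat_of_bool (x == a).
have cE (l : seq R) : count_mem a l = (\sum_(x <- l) F x)%N.
  by rewrite -sum1_count big_mkcond; apply: eq_bigr => x _; rewrite /F /=; case: (x == a).
rewrite !cE hls /multiset_of big_flatten big_map big_filter big_enum_cond /=.
pose f (k : {ffun 'I_s -> 'I_n.+1}) :=
  (\prod_i m i ^ k i * multinom n (fun i => k i) * W (\sum_i k i) *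
   F (\sum_i (k i)%:R * lam i)%R)%N.
transitivity (\sum_(k : {ffun 'I_s -> 'I_n.+1} | (\sum_i k i <= n)%N) f k)%N.
  rewrite [RHS](bigID (fun k : {ffun 'I_s -> 'I_n.+1} => (r0 <= \sum_i k i)%N)) /=.
  rewrite [X in (_ + X)%N]big1 ?addn0 => [|k /andP[_]]; last first.
    by rewrite -ltnNge => h; rewrite /f W0 // muln0 mul0n.
  apply: eq_big => k; first by rewrite andbC.
  by move=> _; rewrite big_nseq iter_addn_0 mulnC.
rewrite (partition_big (fun k : {ffun 'I_s -> 'I_n.+1} =>
  inord (\sum_i k i) : 'I_n.+1) xpredT) //=.
apply: eq_bigr => j _; rewrite (sum_nfold_types F (n := n)); last by rewrite -ltnS.
rewrite !big_distrr /=; apply: eq_big => [k|k].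
  case: (leqP (\sum_i k i) n) => /= h.
    by rewrite -val_eqE /= inordK.
  by symmetry; apply/negP => /eqP e; move: h; rewrite e ltnNge -ltnS ltn_ord.
case/andP=> kn /eqP kj; have kj' : (\sum_i k i = j)%N by rewrite -kj inordK.
rewrite /f multinomE // kj'; ring.
Qed.

End Words.

(** * Extremal eigenvalues *)

Section Extremal.
Variables (R : realType) (n s r0 : nat).
Variables (value : ('I_s -> nat) -> R) (mul : ('I_s -> nat) -> nat).
Let valid (k : 'I_s -> nat) := (r0 <= \sum_i k i <= n)%N.

Lemma count_multiset_of a : count_mem a (multiset_of n r0 value mul) =
  (\sum_(k : {ffun 'I_s -> 'I_n.+1} | valid (fun i => k i) && (value (fun i => k i) == a))
     mul (fun i => k i))%N.
Proof.
rewrite -sum1_count /multiset_of big_flatten big_map big_filter big_enum_cond /=.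
rewrite [RHS]big_mkcondr; apply: eq_bigr => k _.
by rewrite big_mkcond big_nseq iter_addn_0 /=; case: eqP; rewrite ?mul1n ?mul0n.
Qed.

Variable k0 : 'I_s -> nat.
Hypothesis k0_valid : valid k0.
Hypothesis k0_uniq : forall k, valid k -> value k = value k0 -> k =1 k0.

Lemma count_unique : count_mem (value k0) (multiset_of n r0 value mul) = mul k0.
Proof.
have le i : (k0 i <= n)%N.
  case/andP: k0_valid => _; apply: leq_trans.
  by rewrite (bigD1 i) //= leq_addr.
pose f0 : {ffun 'I_s -> 'I_n.+1} := [ffun i => inord (k0 i)].
have f0E : (fun i => nat_of_ord (f0 i)) = k0.
  by apply: boolp.funext => i; rewrite ffunE inordK // ltnS.
rewrite count_multiset_of (bigD1 f0) /=; last by rewrite f0E k0_valid eqxx.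
rewrite f0E big1 ?addn0 // => k /andP[/andP[kv /eqP ke] kn].
case/eqP: kn; apply/ffunP => i; apply: val_inj => /=.
by rewrite ffunE inordK ?ltnS // (k0_uniq kv ke).
Qed.

Variables (V : vectType R) (f : 'End(V)).
Hypothesis f_spec : is_spec f (multiset_of n r0 value mul).
Hypothesis mul_gt0 : (0 < mul k0)%N.

Lemma leigenvalue_mult (g : 'End(V)) a : passmx.leigenvalue g a = (0 < mult g a)%N.
Proof. by rewrite /passmx.leigenvalue /mult lt0n dimv_eq0. Qed.

Lemma leigenvalue_multiset a : passmx.leigenvalue f a ->
  exists2 k, valid k & value k = a.
Proof.
rewrite leigenvalue_mult -f_spec count_multiset_of lt0n sum_nat_eq0 negb_forall.
case/existsP=> k; rewrite negb_imply => /andP[/andP[kv /eqP e] _].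
by exists (fun i => k i : nat).
Qed.

Lemma lambda_max_multiset : (forall k, valid k -> value k <= value k0) ->
  is_lambda_max f (value k0) (mul k0).
Proof.
move=> h; have e : mult f (value k0) = mul k0 by rewrite -f_spec count_unique.
split=> //; first by rewrite leigenvalue_mult e.
by move=> b /leigenvalue_multiset[k /h + <-].
Qed.

Lemma lambda_min_multiset : (forall k, valid k -> value k0 <= value k) ->
  is_lambda_min f (value k0) (mul k0).
Proof.
move=> h; have e : mult f (value k0) = mul k0 by rewrite -f_spec count_unique.
split=> //; first by rewrite leigenvalue_mult e.
by move=> b /leigenvalue_multiset[k /h + <-].
Qed.

End Extremal.

Section Concentrated.
Variables (s : nat) (i0 : 'I_s) (q : nat).

Definition concentrated (i : 'I_s) : nat := if i == i0 then q else 0%N.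

Lemma sum_concentrated : (\sum_i concentrated i = q)%N.
Proof.
rewrite (bigD1 i0) //= /concentrated eqxx big1 ?addn0 // => i h.
by rewrite (negbTE h).
Qed.

Lemma prod_concentrated (m : 'I_s -> nat) : (\prod_i m i ^ concentrated i = m i0 ^ q)%N.
Proof.
rewrite (bigD1 i0) //= /concentrated eqxx big1 ?muln1 // => i h.
by rewrite (negbTE h).
Qed.

Lemma value_concentrated (R : realType) (lam : 'I_s -> R) :
  \sum_i (concentrated i)%:R * lam i = q%:R * lam i0.
Proof.
rewrite (bigD1 i0) //= /concentrated eqxx big1 ?addr0 // => i h.
by rewrite (negbTE h) mul0r.
Qed.

Lemma multinom_concentrated n : (q <= n)%N -> multinom n concentrated = 'C(n, q).
Proof.
move=> qn; rewrite /multinom sum_concentrated -(bin_fact qn).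
rewrite (bigD1 i0) //= big1 => [|i h]; last by rewrite /concentrated (negbTE h).
by rewrite muln1 {1}/concentrated eqxx mulnK // muln_gt0 !fact_gt0.
Qed.

End Concentrated.

Section Order.
Variables (R : realType) (s : nat) (lam : 'I_s -> R).
Hypothesis lam_gt0 : forall i, 0 < lam i.
Variable i0 : 'I_s.
Let value (k : 'I_s -> nat) : R := \sum_i (k i)%:R * lam i.

(** The difference n * lam i0 - value k is the sum of the terms
    k i (lam i0 - lam i) and of (n - sum k) lam i0, all nonnegative. *)
Lemma value_top (k : 'I_s -> nat) n : (forall i, i != i0 -> lam i < lam i0) ->
  (\sum_i k i <= n)%N ->
  value k <= n%:R * lam i0 /\ (value k = n%:R * lam i0 -> k =1 concentrated i0 n).
Proof.
move=> top kn.
have e : n%:R * lam i0 - value k =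
    \sum_i (k i)%:R * (lam i0 - lam i) + (n - \sum_i k i)%:R * lam i0.
  have -> : \sum_i (k i)%:R * (lam i0 - lam i) = (\sum_i k i)%:R * lam i0 - value k.
    by rewrite natr_sum mulr_suml -sumrB; apply: eq_bigr => i _; rewrite mulrBr.
  by rewrite natrB //; ring.
have p1 i : 0 <= (k i)%:R * (lam i0 - lam i).
  apply: mulr_ge0 => //; rewrite subr_ge0.
  by case: (eqVneq i i0) => [->|/top/ltW].
have p2 : 0 <= (n - \sum_i k i)%:R * lam i0 by rewrite mulr_ge0 // ltW.
split; first by rewrite -subr_ge0 e addr_ge0 // sumr_ge0.
move=> /eqP; rewrite eq_sym -subr_eq0 e paddr_eq0 ?sumr_ge0 // psumr_eq0 //.
case/andP=> /allP h; rewrite mulf_eq0 (gt_eqF (lam_gt0 i0)) orbF pnatr_eq0 subn_eq0 => nk.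
have k0 i : i != i0 -> k i = 0%N.
  move=> hi; have := h i (mem_index_enum i); rewrite mulf_eq0 subr_eq0.
  by rewrite (gt_eqF (top _ hi)) orbF pnatr_eq0 => /eqP.
have en : (\sum_i k i)%N = n by apply/eqP; rewrite eqn_leq kn.
move=> i; rewrite /concentrated; case: eqVneq => [->|/k0 //].
by rewrite -en (bigD1 i0) //= big1 ?addn0.
Qed.

(** As in value_top, with the difference split into the terms
    k i (lam i - lam i0) and (sum k - r) lam i0. *)
Lemma value_bottom (k : 'I_s -> nat) r : (forall i, i != i0 -> lam i0 < lam i) ->
  (r <= \sum_i k i)%N ->
  r%:R * lam i0 <= value k /\ (value k = r%:R * lam i0 -> k =1 concentrated i0 r).
Proof.
move=> bot kr.
have e : value k - r%:R * lam i0 =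
    \sum_i (k i)%:R * (lam i - lam i0) + (\sum_i k i - r)%:R * lam i0.
  have -> : \sum_i (k i)%:R * (lam i - lam i0) = value k - (\sum_i k i)%:R * lam i0.
    by rewrite natr_sum mulr_suml -sumrB; apply: eq_bigr => i _; rewrite mulrBr.
  by rewrite natrB //; ring.
have p1 i : 0 <= (k i)%:R * (lam i - lam i0).
  apply: mulr_ge0 => //; rewrite subr_ge0.
  by case: (eqVneq i i0) => [->|/bot/ltW].
have p2 : 0 <= (\sum_i k i - r)%:R * lam i0 by rewrite mulr_ge0 // ltW.
split; first by rewrite -subr_ge0 e addr_ge0 // sumr_ge0.
move=> /eqP; rewrite -subr_eq0 e paddr_eq0 ?sumr_ge0 // psumr_eq0 //.
case/andP=> /allP h; rewrite mulf_eq0 (gt_eqF (lam_gt0 i0)) orbF pnatr_eq0 subn_eq0 => nk.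
have k0 i : i != i0 -> k i = 0%N.
  move=> hi; have := h i (mem_index_enum i); rewrite mulf_eq0 subr_eq0.
  by rewrite (gt_eqF (bot _ hi)) orbF pnatr_eq0 => /eqP.
have en : (\sum_i k i)%N = r by apply/eqP; rewrite eqn_leq kr andbT.
move=> i; rewrite /concentrated; case: eqVneq => [->|/k0 //].
by rewrite -en (bigD1 i0) //= big1 ?addn0.
Qed.

End Order.

(** The Laplacian in degree 0 involves chains on at most two vertices, where
    the weights 0! and 1! are 1. *)
Lemma canonical_normalized0 (R : realType) (G : digraph) :
  canonical_hodge R G 0 = normalized_hodge R G 0.
Proof.
have e q : (q <= 2)%N -> @ipOmega R G (@dotc R G) q = @ipOmega R G (@ndot R G) q.
  move=> q2; apply: boolp.funext => u; apply: boolp.funext => v.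
  rewrite /ipOmega /ndot (_ : (q.-1)`! = 1)%N ?invr1 ?mul1r //.
  by case: q q2 {u v} => [|[|[|]]].
by rewrite /canonical_hodge /normalized_hodge ndotE /hodge /bdOmega_adj !e.
Qed.

Lemma perm_eq_size_nonzero (R : realType) (A B : seq R) : size A = size B ->
  (forall a, a != 0 -> count_mem a A = count_mem a B) -> perm_eq A B.
Proof.
move=> sAB h.
have p : perm_eq [seq x <- A | x != 0] [seq x <- B | x != 0].
  apply/allP => a _; apply/eqP; rewrite !count_filter.
  case: (eqVneq a 0) => [->|a0].
    by rewrite !(eq_count (a2 := pred0)) ?count_pred0 // => x /=; case: eqP.
  rewrite (eq_count (a2 := pred1 a)) => [|x /=]; last by case: eqP => // ->.
  rewrite [RHS](eq_count (a2 := pred1 a)) ?h // => x /=; by case: eqP => // ->.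
have cs (S : seq R) : count_mem 0 S = (size S - size [seq x <- S | x != 0%R])%N.
  rewrite size_filter -(count_predC (pred1 0%R) S) addnK //.
apply/allP => a _; apply/eqP; case: (eqVneq a 0) => [->|]; last exact: h.
by rewrite !cs sAB (perm_size p).
Qed.

(** * The spectrum of Cartesian powers *)

Unset Implicit Arguments.
Set Strict Implicit.

Theorem theorem7p2 (R : realType) (G : digraph)
    (Gconn : connected G)
    (Gdouble : ~ has_double_arrow G)
    (Gtriangle : ~ has_triangle G)
    (Gsquare : ~ has_square G)
    (s : nat) (lam : s.-tuple R) (m : s.-tuple nat)
    (lam_sorted : sorted <%R lam)
    (lam_eigen : forall a : R,
       (a \in lam) = (0 < a) && passmx.leigenvalue (canonical_hodge R G 0) a)
    (m_mult : forall i : 'I_s,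
       tnth m i = mult (canonical_hodge R G 0) (tnth lam i))
    (n : nat) (n_ge1 : (1 <= n)%N) :
  ((#|arrows G| = #|G| -> (3 <= #|G|)%N ->
    forall r : nat, (r <= n)%N ->
    [/\ is_spec (normalized_hodge R (box_pow G n) r)
          (multiset_of n 0
             (fun k : 'I_s -> nat => \sum_(i < s) (k i)%:R * tnth lam i)
             (fun k => (\prod_(i < s) tnth m i ^ k i
                        * multinom n k * 'C(n, r))%N)),
        is_lambda_max (normalized_hodge R (box_pow G n) r)
          (n%:R * last 0 lam) (last 0%N m ^ n * 'C(n, r))%N
      & is_lambda_min (normalized_hodge R (box_pow G n) r) 0 'C(n, r)])
  /\
  (#|arrows G| = #|G|.-1 -> (2 <= #|G|)%N ->
    forall r : nat, (r <= n)%N ->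
    [/\ is_spec (normalized_hodge R (box_pow G n) r)
          (multiset_of n r
             (fun k : 'I_s -> nat => \sum_(i < s) (k i)%:R * tnth lam i)
             (fun k => (\prod_(i < s) tnth m i ^ k i
                        * multinom n k * 'C(\sum_(i < s) k i, r))%N)),
        is_lambda_max (normalized_hodge R (box_pow G n) r)
          (n%:R * last 0 lam) (last 0%N m ^ n * 'C(n, r))%N
      & is_lambda_min (normalized_hodge R (box_pow G n) r)
          (r%:R * head 0 lam) (head 0%N m ^ r * 'C(n, r))%N])).
Proof.
have Gthin := thinP Gdouble Gtriangle Gsquare.
have [S0 [S1 [[hV hE size0 size1] [S0ge0 zero1 S01]]]] := base_spectra R Gconn.
have count0 a : count_mem a S0 = mult (canonical_hodge R G 0) a.
  by rewrite canonical_normalized0 (has_spec_mult a (has_spec_vertex hV)).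
have lam_gt0 i : 0 < tnth lam i.
  by have := mem_tnth i lam; rewrite lam_eigen => /andP[].
have m_gt0 i : (0 < tnth m i)%N.
  by have := mem_tnth i lam; rewrite lam_eigen m_mult leigenvalue_mult => /andP[].
pose T := blocks (tnth lam) (tnth m).
have countT a : count_mem a T = (\sum_i tnth m i * (tnth lam i == a))%N.
  rewrite -sum1_count big_mkcond sum_blocks.
  by apply: eq_bigr => i _ /=; case: (_ == a).
have lam_uniq : uniq lam := lt_sorted_uniq lam_sorted.
(* The eigenvalues in degree 0 are 0, once, and the given ones. *)
have p0 : (0 < #|G|)%N -> perm_eq S0 (0 :: T).
  move=> G0; apply/allP => a _; apply/eqP; rewrite [RHS]/= countT.
  case: (boolP (a \in lam)) => [al|nal].
    have /tnthP[i ai] := al; rewrite (bigD1 i) //= -ai eqxx muln1 big1 => [|j ji].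
      rewrite addn0 m_mult -ai -count0 ai; have := lam_gt0 i.
      by case: eqP => // <-; rewrite ltxx.
    rewrite ai; case: eqP => [e|_]; last by rewrite muln0.
    move/eqP: e; rewrite !(tnth_nth 0) nth_uniq ?size_tuple ?ltn_ord // => e.
    by case/negP: ji.
  rewrite big1 => [|i _]; last first.
    case: eqP => [e|_]; last by rewrite muln0.
    by move: nal; rewrite -e mem_tnth.
  rewrite addn0; case: (eqVneq 0 a) => [<-|a0]; first by rewrite zero1.
  move: nal; rewrite lam_eigen negb_and -leNgt leigenvalue_mult -count0 -leqNgt leqn0.
  case/orP=> [ale|/eqP ->] //; apply/eqP; rewrite -leqn0 leqNgt -has_count.
  apply/hasPn => x xS /=; apply: contra a0 => /eqP xa.
  by rewrite eq_le ale andbT -xa S0ge0.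
(* With two vertices or more, a simple eigenvalue 0 leaves room for others. *)
have s_gt0 : (2 <= #|G|)%N -> (0 < s)%N.
  move=> G2; have := perm_size (p0 (ltnW G2)); rewrite size0 /= => sT.
  rewrite lt0n; apply/eqP => s0; move: G2; rewrite sT ltnS -[size T]sum1_size.
  by rewrite sum_blocks; move: (tnth m); rewrite s0 => m'; rewrite big_ord0.
have last_lam (sp : (0 < s)%N) : exists2 i : 'I_s,
    last 0 lam = tnth lam i /\ last 0%N m = tnth m i &
    forall j, j != i -> tnth lam j < tnth lam i.
  have h : (s.-1 < s)%N by rewrite prednK.
  exists (Ordinal h); first by rewrite !(tnth_nth 0) -!nth_last !size_tuple.
  move=> j ji; rewrite !(tnth_nth 0).
  apply: (sorted_ltn_nth lt_trans) => //; rewrite ?inE ?size_tuple //=.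
  by have := ltn_ord j; move: ji; rewrite -val_eqE /=; lia.
have head_lam (sp : (0 < s)%N) : exists2 i : 'I_s,
    head 0 lam = tnth lam i /\ head 0%N m = tnth m i &
    forall j, j != i -> tnth lam i < tnth lam j.
  exists (Ordinal sp); first by rewrite !(tnth_nth 0) /= !nth0.
  move=> j ji; rewrite !(tnth_nth 0).
  apply: (sorted_ltn_nth lt_trans) => //; rewrite ?inE ?size_tuple //=.
  by move: ji; rewrite -val_eqE /=; lia.
case: n n_ge1 => // n _; split=> [Gv G3|Gv G2] r rn.
  have G2 : (2 <= #|G|)%N := ltnW G3; have G1 : (0 < #|G|)%N := ltnW G2.
  have sp := s_gt0 G2; have {p0}p0 := p0 G1.
  (* Equal sizes and equal nonzero parts: here 0 is also once in S1. *)
  have p1 : perm_eq S1 (0 :: T).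
    apply: perm_trans p0; apply: perm_eq_size_nonzero; first by rewrite size0 size1.
    by move=> a a0; rewrite S01.
  have spec : is_spec (normalized_hodge R (box_pow G n.+1) r)
      (multiset_of n.+1 0 (fun k : 'I_s -> nat => \sum_i (k i)%:R * tnth lam i)
         (fun k => (\prod_i tnth m i ^ k i * multinom n.+1 k * 'C(n.+1, r))%N)).
    move=> a; rewrite (has_spec_mult a (has_spec_pow n r Gthin hV hE)).
    apply: (@count_multiset _ _ _ _ _ _ (fun=> 'C(n.+1, r))) => // F.
    exact: sum_spectra_cycle.
  split=> //.
    have [i [-> ->] top] := last_lam sp.
    have := @lambda_max_multiset R n.+1 s 0 _ _ (concentrated i n.+1) _ _ _ _ spec.
    rewrite value_concentrated prod_concentrated multinom_concentrated // binn muln1.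
    apply.
    - by rewrite sum_concentrated leqnn.
    - move=> k /andP[_ kn]; exact: (value_top lam_gt0 top kn).2.
    - by rewrite muln_gt0 expn_gt0 m_gt0 bin_gt0.
    by move=> k /andP[_ kn]; exact: (value_top lam_gt0 top kn).1.
  have [i _ bot] := head_lam sp.
  have := @lambda_min_multiset R n.+1 s 0 _ _ (concentrated i 0) _ _ _ _ spec.
  rewrite value_concentrated prod_concentrated multinom_concentrated // bin0 !mul1n mul0r.
  apply.
  - by rewrite sum_concentrated.
  - move=> k _ h; apply: (value_bottom lam_gt0 bot (leq0n _)).2.
    by rewrite mul0r.
  - by rewrite bin_gt0.
  move=> k _; have := (value_bottom lam_gt0 bot (leq0n (\sum_i k i)%N)).1.
  by rewrite mul0r.
have G1 : (0 < #|G|)%N := ltnW G2.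
have sp := s_gt0 G2; have {p0}p0 := p0 G1.
(* One entry less than in S0 with the same nonzero part: here 0 is not in S1. *)
have p1 : perm_eq S1 T.
  apply: perm_eq_size_nonzero; first by rewrite size1 Gv -size0 (perm_size p0).
  move=> a a0; rewrite -S01 // (permP p0) /= eq_sym.
  by rewrite (negbTE a0).
have spec : is_spec (normalized_hodge R (box_pow G n.+1) r)
    (multiset_of n.+1 r (fun k : 'I_s -> nat => \sum_i (k i)%:R * tnth lam i)
       (fun k => (\prod_i tnth m i ^ k i * multinom n.+1 k * 'C(\sum_i k i, r))%N)).
  move=> a; rewrite (has_spec_mult a (has_spec_pow n r Gthin hV hE)).
  apply: (@count_multiset _ _ _ _ _ _ (fun j => 'C(j, r))) => [j|F].
    exact: bin_small.
  exact: sum_spectra_tree.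
split=> //.
  have [i [-> ->] top] := last_lam sp.
  have := @lambda_max_multiset R n.+1 s r _ _ (concentrated i n.+1) _ _ _ _ spec.
  rewrite value_concentrated prod_concentrated multinom_concentrated // binn muln1.
  rewrite sum_concentrated; apply.
  - by rewrite rn leqnn.
  - move=> k /andP[_ kn]; exact: (value_top lam_gt0 top kn).2.
  - by rewrite muln_gt0 expn_gt0 m_gt0 bin_gt0.
  by move=> k /andP[_ kn]; exact: (value_top lam_gt0 top kn).1.
have [i [-> ->] bot] := head_lam sp.
have := @lambda_min_multiset R n.+1 s r _ _ (concentrated i r) _ _ _ _ spec.
rewrite value_concentrated prod_concentrated multinom_concentrated //.
rewrite sum_concentrated binn muln1; apply.
- by rewrite leqnn.
- move=> k /andP[kr _]; exact: (value_bottom lam_gt0 bot kr).2.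
- by rewrite muln_gt0 expn_gt0 m_gt0 bin_gt0 rn.
by move=> k /andP[kr _]; exact: (value_bottom lam_gt0 bot kr).1.
Qed.
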